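(* $\mathcal{H}_{\mathcal{SP}}^+$, with its product, the product $\nwarrow$ and the coproducts $\Delta_\prec,\Delta_\succ$, is a $Dup$-$Dend$ bialgebra.
   Context: $\mathbb{K}$ is a commutative field. A special poset is a finite set with two partial orders $(P,\leq_1,\leq_2)$ with $\leq_2$ total, considered up to isomorphism; subsets are special posets by restriction. $\mathcal{H}_{\mathcal{SP}}^+$ is the $\mathbb{K}$-vector space with basis the nonempty special posets (the augmentation ideal of $\mathcal{H}_{\mathcal{SP}}$). For nonempty special posets $P,Q$: - $PQ$ is the disjoint union of $P$ and $Q$, with $P,Q$ as special subposets, $x\leq_2 y$ for $x\in P,y\in Q$, and no element of $P$ being $\leq_1$-comparable to an element of $Q$. - $g_P$ is the maximal element of $(P,\leq_2)$. $P\nwarrow Q$ is the disjoint union of $P$ and $Q$, with $P,Q$ as special subposets, and for $x\in P$, $y\in Q$: $x\leq_2 y$; $x\leq_1 y$ iff $x\leq_1 g_P$ (and never $y\leq_1 x$). - An ideal of $P$ is a subset $I$ such that $x\in I$, $x\leq_1 y$ imply $y\in I$; it is non trivial if $I\neq\emptyset,P$. $\tilde\Delta(P)=\sum_I (P\setminus I)\otimes I$ over non trivial ideals; $\Delta_\prec(P)$ (resp. $\Delta_\succ(P)$) is the same sum restricted to non trivial ideals $I$ with $g_P\notin I$ (resp. $g_P\in I$). So $\tilde\Delta=\Delta_\prec+\Delta_\succ$. A $Dup$-$Dend$ bialgebra is a vector space $A$ with two products $\cdot$ (denoted by juxtaposition), $\nwarrow$ and two coproducts $\Delta_\prec,\Delta_\succ:A\to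 A\otimes A$ such that, with $\tilde\Delta=\Delta_\prec+\Delta_\succ$: (i) (duplicial algebra) $(xy)z=x(yz)$, $(x\nwarrow y)\nwarrow z=x\nwarrow(y\nwarrow z)$, $(xy)\nwarrow z=x(y\nwarrow z)$; (ii) (dendriform coalgebra) $(\Delta_\prec\otimes Id)\circ\Delta_\prec=(Id\otimes\tilde\Delta)\circ\Delta_\prec$, $(\Delta_\succ\otimes Id)\circ\Delta_\prec=(Id\otimes\Delta_\prec)\circ\Delta_\succ$, $(\tilde\Delta\otimes Id)\circ\Delta_\succ=(Id\otimes\Delta_\succ)\circ\Delta_\succ$; (iii) for all $x,y\in A$, with Sweedler notations $\tilde\Delta(a)=a'\otimes a''$, $\Delta_\prec(a)=a'_\prec\otimes a''_\prec$, $\Delta_\succ(a)=a'_\succ\otimes a''_\succ$: $\Delta_\prec(xy)=y\otimes x+y'_\prec\otimes xy''_\prec+xy'_\prec\otimes y''_\prec+x'y\otimes x''+x'y'_\prec\otimes x''y''_\prec$, $\Delta_\succ(xy)=x\otimes y+xy'_\succ\otimes y''_\succ+y'_\succ\otimes xy''_\succ+x'\otimes x''y+x'y'_\succ\otimes x''y''_\succ$, $\Delta_\prec(x\nwarrow y)=x\nwarrow y'_\prec\otimes y''_\prec+x'_\prec\nwarrow y\otimes x''_\prec+x'_\prec\nwarrow y'_\prec\otimes x''_\prec y''_\prec$, $\Delta_\succ(x\nwarrow y)=x\otimes y+x\nwarrow y'_\succ\otimes y''_\succ+x'_\succ\otimes x''_\succ\nwarrow y+x'_\prec\otimes x''_\prec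 y+x'_\prec\nwarrow y'_\succ\otimes x''_\prec y''_\succ$. (Here $a\nwarrow b\otimes c$ means $(a\nwarrow b)\otimes c$ and $a\otimes b\nwarrow c$ means $a\otimes(b\nwarrow c)$.) *)

(* Defs.v *)
From HB Require Import structures.
From mathcomp Require Import all_boot all_order all_algebra.
From mathcomp Require Import boolp.
From mathcomp Require Import freeg.

Set Implicit Arguments.
Unset Strict Implicit.
Unset Printing Implicit Defensive.

Import GRing.Theory.
Local Open Scope ring_scope.
Local Open Scope quotient_scope.

Section FreeVector.
Variables (K : fieldType) (T : choiceType) (V : lmodType K).
Implicit Types (f : T -> V) (x y : {freeg T / K}).

Lemma freeg_lin_ind (Q : {freeg T / K} -> Prop) :
  Q 0 -> (forall k t x, Q x -> Q (k *: << t >> + x)) -> forall x, Q x.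
Proof.
move=> Q0 Qs x; rewrite -[x]freeg_sumE.
elim: (dom x) => [|t s IHs]; first by rewrite big_nil.
rewrite big_cons.
have -> : << coeff t x *g t >> = coeff t x *: << t >> :> {freeg T / K}.
  by apply/eqP/freeg_eqP => u; rewrite coeffZ !coeffU mul1r.
exact: Qs.
Qed.

Lemma fglift_basis f t : fglift f << t >> = f t.
Proof. by rewrite liftU scale1r. Qed.

Lemma fglift0 f : fglift f 0 = 0.
Proof. by have := lift_is_additive f 0 0; rewrite !subrr. Qed.

Lemma fgliftB f x y : fglift f (x - y) = fglift f x - fglift f y.
Proof. exact: lift_is_additive. Qed.

Lemma fgliftD f x y : fglift f (x + y) = fglift f x + fglift f y.
Proof.
have N : fglift f (- y) = - fglift f y by rewrite -sub0r fgliftB fglift0 sub0r.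
by rewrite -[in LHS](opprK y) fgliftB N opprK.
Qed.

Lemma fgliftZ f k x : fglift f (k *: x) = k *: fglift f x.
Proof.
elim/freeg_lin_ind: x => [|c t x IHx]; first by rewrite scaler0 fglift0 scaler0.
have E d : fglift f (d *: << t >>) = d *: f t.
  have -> : d *: << t >> = << d *g t >> :> {freeg T / K}.
    by apply/eqP/freeg_eqP => u; rewrite coeffZ !coeffU mul1r.
  by rewrite liftU.
by rewrite scalerDr !fgliftD IHx scalerA !E scalerDr scalerA.
Qed.

Lemma fglift_linear f : linear (fglift f).
Proof. by move=> k x y; rewrite fgliftD fgliftZ. Qed.

End FreeVector.

Definition bilinear_map (K : fieldType) (U V W : lmodType K)
    (f : U -> V -> W) : Prop :=
  (forall v, linear (f^~ v)) /\ (forall u, linear (f u)).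

Section Tensor.
Variables (K : fieldType) (A B : lmodType K).

(* The subspace of the free vector space on A * B spanned by the bilinearity
   relations. *)
Inductive tensor_rel : {freeg (A * B)%type / K} -> Prop :=
| TensorAddl a a' b : tensor_rel (<< (a + a', b) >> - << (a, b) >> - << (a', b) >>)
| TensorAddr a b b' : tensor_rel (<< (a, b + b') >> - << (a, b) >> - << (a, b') >>)
| TensorScalel k a b : tensor_rel (<< (k *: a, b) >> - k *: << (a, b) >>)
| TensorScaler k a b : tensor_rel (<< (a, k *: b) >> - k *: << (a, b) >>)
| TensorZero : tensor_rel 0
| TensorAdd x y : tensor_rel x -> tensor_rel y -> tensor_rel (x + y)
| TensorScale k x : tensor_rel x -> tensor_rel (k *: x).

Definition tensor_relb : {pred {freeg (A * B)%type / K}} :=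
  fun x => `[< tensor_rel x >].

Lemma tensor_relb_closed : zmod_closed tensor_relb.
Proof.
split=> [|x y /asboolP rx /asboolP ry]; apply/asboolP; first exact: TensorZero.
by apply: TensorAdd => //; rewrite -scaleN1r; apply: TensorScale.
Qed.

HB.instance Definition _ :=
  GRing.isZmodClosed.Build {freeg (A * B)%type / K} tensor_relb
    tensor_relb_closed.

Definition tensor : Type := Quotient.quot tensor_relb.

HB.instance Definition _ := GRing.Zmodule.on tensor.

Definition tensor_pi (x : {freeg (A * B)%type / K}) : tensor :=
  \pi_(Quotient.quot tensor_relb) x.

Definition tensor_repr (t : tensor) : {freeg (A * B)%type / K} :=
  repr (t : Quotient.quot tensor_relb).

Lemma tensor_reprK t : tensor_pi (tensor_repr t) = t.
Proof. exact: reprK. Qed.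

Lemma tensor_piP x y : tensor_pi x = tensor_pi y <-> tensor_rel (x - y).
Proof.
rewrite /tensor_pi; split=> [/eqP|r].
  by rewrite -Quotient.idealrBE => /asboolP.
by apply/eqP; rewrite -Quotient.idealrBE; apply/asboolP.
Qed.

Lemma tensor_piD x y : tensor_pi (x + y) = tensor_pi x + tensor_pi y.
Proof. exact: Quotient.pi_add. Qed.

Definition tensor_scale (k : K) (t : tensor) : tensor :=
  tensor_pi (k *: tensor_repr t).

Lemma tensor_scale_pi k x : tensor_scale k (tensor_pi x) = tensor_pi (k *: x).
Proof.
apply/tensor_piP; rewrite -scalerBr; apply: TensorScale.
by apply/tensor_piP; rewrite tensor_reprK.
Qed.

Lemma tensor_scaleA a b t :
  tensor_scale a (tensor_scale b t) = tensor_scale (a * b) t.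
Proof. by rewrite -[t]tensor_reprK !tensor_scale_pi scalerA. Qed.

Lemma tensor_scale1 : left_id 1 tensor_scale.
Proof. by move=> t; rewrite -[t]tensor_reprK tensor_scale_pi scale1r. Qed.

Lemma tensor_scaleDr : right_distributive tensor_scale +%R.
Proof.
move=> k t u; rewrite -[t]tensor_reprK -[u]tensor_reprK -tensor_piD.
by rewrite !tensor_scale_pi scalerDr tensor_piD.
Qed.

Lemma tensor_scaleDl t : {morph tensor_scale^~ t : a b / a + b}.
Proof.
by move=> a b; rewrite -[t]tensor_reprK !tensor_scale_pi scalerDl tensor_piD.
Qed.

HB.instance Definition _ := GRing.Zmodule_isLmodule.Build K tensor
  tensor_scaleA tensor_scale1 tensor_scaleDr tensor_scaleDl.

Lemma tensor_piZ k x : tensor_pi (k *: x) = k *: tensor_pi x.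
Proof. by rewrite -tensor_scale_pi. Qed.

Definition tens (a : A) (b : B) : tensor := tensor_pi << (a, b) >>.

Lemma tensDl a a' b : tens (a + a') b = tens a b + tens a' b.
Proof.
rewrite /tens -tensor_piD; apply/tensor_piP; rewrite opprD addrA.
exact: TensorAddl.
Qed.

Lemma tensDr a b b' : tens a (b + b') = tens a b + tens a b'.
Proof.
rewrite /tens -tensor_piD; apply/tensor_piP; rewrite opprD addrA.
exact: TensorAddr.
Qed.

Lemma tensZl k a b : tens (k *: a) b = k *: tens a b.
Proof. by rewrite /tens -tensor_piZ; apply/tensor_piP; apply: TensorScalel. Qed.

Lemma tensZr k a b : tens a (k *: b) = k *: tens a b.
Proof. by rewrite /tens -tensor_piZ; apply/tensor_piP; apply: TensorScaler. Qed.

Lemma tens_bilinear : bilinear_map tens.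
Proof.
by split=> [b k x y|a k x y]; rewrite ?tensDl ?tensZl ?tensDr ?tensZr.
Qed.

Lemma tensor_ind (Q : tensor -> Prop) :
  Q 0 -> (forall a b t, Q t -> Q (tens a b + t)) -> forall t, Q t.
Proof.
move=> Q0 Qs t; rewrite -[t]tensor_reprK.
elim/freeg_lin_ind: (tensor_repr t) => [|k [a b] x IHx].
  have -> // : tensor_pi 0 = 0.
  by rewrite -(scale0r (0 : {freeg (A * B)%type / K})) tensor_piZ scale0r.
by rewrite tensor_piD tensor_piZ -/(tens a b) -tensZl; apply: Qs.
Qed.

(* The linear map on the tensor product induced by f; it is meaningful when f
   is bilinear (see [tlift_tens], [tlift_linear]). *)
Definition tlift (V : lmodType K) (f : A -> B -> V) (t : tensor) : V :=
  fglift (fun p => f p.1 p.2) (tensor_repr t).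

Section Universal.
Variables (V : lmodType K) (f : A -> B -> V).
Hypothesis f_bilinear : bilinear_map f.

Lemma tlift_pi x : tlift f (tensor_pi x) = fglift (fun p => f p.1 p.2) x.
Proof.
have [fl fr] := f_bilinear.
suff K0 y : tensor_rel y -> fglift (fun p => f p.1 p.2) y = 0.
  apply/eqP; rewrite -subr_eq0 -fgliftB K0 //.
  by apply/tensor_piP; rewrite tensor_reprK.
elim=> {y} [a a' b|a b b'|k a b|k a b||y z _ Hy _ Hz|k y _ Hy].
- rewrite !fgliftB !fglift_basis /= -[a in f (a + _)]scale1r.
  by rewrite (fl b 1 a a') scale1r -addrA -opprD subrr.
- rewrite !fgliftB !fglift_basis /= -[b in f _ (b + _)]scale1r.
  by rewrite (fr a 1 b b') scale1r -addrA -opprD subrr.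
- have f0 : f 0 b = 0.
    have := fl b 1 0 0; rewrite !scale1r addr0 => /esym /eqP.
    by rewrite -subr_eq0 addrK => /eqP.
  rewrite fgliftB fgliftZ !fglift_basis /=.
  by rewrite -[k *: a]addr0 (fl b k a 0) f0 addr0 subrr.
- have f0 : f a 0 = 0.
    have := fr a 1 0 0; rewrite !scale1r addr0 => /esym /eqP.
    by rewrite -subr_eq0 addrK => /eqP.
  rewrite fgliftB fgliftZ !fglift_basis /=.
  by rewrite -[k *: b]addr0 (fr a k b 0) f0 addr0 subrr.
- exact: fglift0.
- by rewrite fgliftD Hy Hz addr0.
- by rewrite fgliftZ Hy scaler0.
Qed.

Lemma tlift_tens a b : tlift f (tens a b) = f a b.
Proof. by rewrite tlift_pi fglift_basis. Qed.

Lemma tlift_linear : linear (tlift f).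
Proof.
move=> k t u; rewrite -[t]tensor_reprK -[u]tensor_reprK.
by rewrite -tensor_piZ -tensor_piD !tlift_pi fglift_linear.
Qed.

End Universal.
End Tensor.

Arguments tensor {K} A B.

Notation "A ⊗ B" := (tensor A B)
  (at level 40, left associativity) : type_scope.
Notation "a ⊗ b" := (tens a b) (at level 40, left associativity) : ring_scope.

(* Sweedler notation: if t is the sum of the a_i ⊗ b_i, then
   \sw ( a , b <- t ) E a b is the sum of the E a_i b_i (E bilinear). *)
Notation "\sw ( a , b <- t ) E" := (tlift (fun a b => E) t)
  (at level 41, E at level 41, a name, b name, t at level 200,
   format "\sw ( a ,  b  <-  t )  E") : ring_scope.

Section TensorMaps.
Variable K : fieldType.

Definition tmap (A B C D : lmodType K) (f : A -> C) (g : B -> D)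
    (t : (A ⊗ B)%type) : (C ⊗ D)%type :=
  \sw (a, b <- t) (f a ⊗ g b).

Definition tassoc (A B C : lmodType K) (t : (A ⊗ B ⊗ C)%type) :
    (A ⊗ (B ⊗ C))%type :=
  \sw (s, c <- t) \sw (a, b <- s) (a ⊗ (b ⊗ c)).

End TensorMaps.

Section DupDend.
Variables (K : fieldType) (A : lmodType K).

Record duplicial_algebra (mul nw : A -> A -> A) : Prop := DuplicialAlgebra {
  dup_mul_bilinear : bilinear_map mul;
  dup_nw_bilinear : bilinear_map nw;
  dup_mulA : forall x y z, mul (mul x y) z = mul x (mul y z);
  dup_nwA : forall x y z, nw (nw x y) z = nw x (nw y z);
  dup_mul_nw : forall x y z, nw (mul x y) z = mul x (nw y z)
}.

Definition coprod (dl dr : A -> (A ⊗ A)%type) (x : A) : (A ⊗ A)%type :=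
  dl x + dr x.

Record dendriform_coalgebra (dl dr : A -> (A ⊗ A)%type) : Prop :=
  DendriformCoalgebra {
  dend_left_linear : linear dl;
  dend_right_linear : linear dr;
  dend_left : forall x,
    tassoc (tmap dl id (dl x)) = tmap id (coprod dl dr) (dl x);
  dend_middle : forall x,
    tassoc (tmap dr id (dl x)) = tmap id dl (dr x);
  dend_right : forall x,
    tassoc (tmap (coprod dl dr) id (dr x)) = tmap id dr (dr x)
}.

Section Compatibility.
Variables (mul nw : A -> A -> A) (dl dr : A -> (A ⊗ A)%type).
Let d := coprod dl dr.
Local Notation "x · y" := (mul x y) (at level 40, left associativity).
Local Notation "x ↖ y" := (nw x y) (at level 40, left associativity).

Definition compat_left_mul : Prop := forall x y,
  dl (x · y) =
    y ⊗ x
    + \sw (y1, y2 <- dl y) (y1 ⊗ (x · y2))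
    + \sw (y1, y2 <- dl y) ((x · y1) ⊗ y2)
    + \sw (x1, x2 <- d x) ((x1 · y) ⊗ x2)
    + \sw (x1, x2 <- d x) \sw (y1, y2 <- dl y) ((x1 · y1) ⊗ (x2 · y2)).

Definition compat_right_mul : Prop := forall x y,
  dr (x · y) =
    x ⊗ y
    + \sw (y1, y2 <- dr y) ((x · y1) ⊗ y2)
    + \sw (y1, y2 <- dr y) (y1 ⊗ (x · y2))
    + \sw (x1, x2 <- d x) (x1 ⊗ (x2 · y))
    + \sw (x1, x2 <- d x) \sw (y1, y2 <- dr y) ((x1 · y1) ⊗ (x2 · y2)).

Definition compat_left_nw : Prop := forall x y,
  dl (x ↖ y) =
    \sw (y1, y2 <- dl y) ((x ↖ y1) ⊗ y2)
    + \sw (x1, x2 <- dl x) ((x1 ↖ y) ⊗ x2)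
    + \sw (x1, x2 <- dl x) \sw (y1, y2 <- dl y) ((x1 ↖ y1) ⊗ (x2 · y2)).

Definition compat_right_nw : Prop := forall x y,
  dr (x ↖ y) =
    x ⊗ y
    + \sw (y1, y2 <- dr y) ((x ↖ y1) ⊗ y2)
    + \sw (x1, x2 <- dr x) (x1 ⊗ (x2 ↖ y))
    + \sw (x1, x2 <- dl x) (x1 ⊗ (x2 · y))
    + \sw (x1, x2 <- dl x) \sw (y1, y2 <- dr y) ((x1 ↖ y1) ⊗ (x2 · y2)).

Record dup_dend_bialgebra : Prop := DupDendBialgebra {
  dd_duplicial : duplicial_algebra mul nw;
  dd_dendriform : dendriform_coalgebra dl dr;
  dd_left_mul : compat_left_mul;
  dd_right_mul : compat_right_mul;
  dd_left_nw : compat_left_nw;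
  dd_right_nw : compat_right_nw
}.

End Compatibility.
End DupDend.

Definition partial_order (T : Type) (le : rel T) : Prop :=
  [/\ reflexive le, antisymmetric le & transitive le].

(* The carriers live in [Set], so that the type of special posets is small
   enough to carry a [choiceType] structure; with carriers in [finType] it is
   not, by universe constraints of the library. *)
Record sposet := SPoset {
  sp_carrier :> Set;
  sp_finite : Finite sp_carrier;
  le1 : rel sp_carrier;
  le2 : rel sp_carrier;
  le1_order : partial_order le1;
  le2_order : partial_order le2;
  le2_total : total le2
}.
Arguments le1 {s} x y : rename.
Arguments le2 {s} x y : rename.

HB.instance Definition _ (P : sposet) : Finite (sp_carrier P) := sp_finite P.

Definition sp_iso (P Q : sposet) : Prop :=
  exists f : P -> Q, [/\ bijective f,
    forall x y, le1 (f x) (f y) = le1 x y &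
    forall x y, le2 (f x) (f y) = le2 x y].

Record nsposet := NSPoset {
  ns_sp :> sposet;
  ns_nonempty : (0 < #|{: ns_sp}|)%N
}.

HB.instance Definition _ := gen_eqMixin nsposet.
HB.instance Definition _ := gen_choiceMixin nsposet.

Lemma sp_iso_refl P : sp_iso P P.
Proof. by exists id; split=> //; exists id. Qed.

Lemma sp_iso_sym P Q : sp_iso P Q -> sp_iso Q P.
Proof.
case=> f [[g fK gK] f1 f2]; exists g; split; first by exists f.
- by move=> x y; rewrite -f1 !gK.
- by move=> x y; rewrite -f2 !gK.
Qed.

Lemma sp_iso_trans P Q R : sp_iso P Q -> sp_iso Q R -> sp_iso P R.
Proof.
case=> f [bf f1 f2] [g [bg g1 g2]]; exists (g \o f); split=> [|x y|x y] /=.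
- exact: bij_comp.
- by rewrite g1 f1.
- by rewrite g2 f2.
Qed.

Definition ns_isob (P Q : nsposet) : bool := `[< sp_iso P Q >].

Lemma ns_isob_refl : reflexive ns_isob.
Proof. by move=> P; apply/asboolP; apply: sp_iso_refl. Qed.

Lemma ns_isob_sym : symmetric ns_isob.
Proof. by move=> P Q; apply/asboolP/asboolP; apply: sp_iso_sym. Qed.

Lemma ns_isob_trans : transitive ns_isob.
Proof.
by move=> Q P R /asboolP i /asboolP j; apply/asboolP; apply: sp_iso_trans i j.
Qed.

Canonical ns_iso_equiv :=
  EquivRel ns_isob ns_isob_refl ns_isob_sym ns_isob_trans.

Definition spclass := {eq_quot ns_isob}.

HB.instance Definition _ := Choice.on spclass.
HB.instance Definition _ := Quotient.on spclass.

Definition iso_class (P : nsposet) : spclass := \pi_spclass P.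
Definition class_repr (c : spclass) : nsposet := repr c.

Lemma class_reprK c : iso_class (class_repr c) = c.
Proof. exact: reprK. Qed.

Lemma iso_classP (P Q : nsposet) : iso_class P = iso_class Q <-> sp_iso P Q.
Proof.
split=> [/eqmodP /asboolP //|i]; by apply/eqmodP; apply/asboolP.
Qed.

Lemma class_repr_iso P : sp_iso (class_repr (iso_class P)) P.
Proof. by apply/iso_classP; rewrite class_reprK. Qed.

Section Sub.
Variables (P : sposet) (A : {set P}).

Lemma sub_order (le : rel P) : partial_order le ->
  partial_order (fun x y : {x : P | x \in A} => le (val x) (val y)).
Proof.
case=> r a t; split=> [x|x y /a /val_inj //|y x z]; [exact: r|exact: t].
Qed.

Definition sp_sub : sposet :=
  @SPoset {x : P | x \in A} (Finite.class {x : P | x \in A})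
    (fun x y => le1 (val x) (val y)) (fun x y => le2 (val x) (val y))
    (sub_order (le1_order P)) (sub_order (le2_order P))
    (fun x y => @le2_total P (val x) (val y)).

Lemma sub_nonempty : A != set0 -> (0 < #|{: sp_sub}|)%N.
Proof. by rewrite /= card_sig (@eq_card _ _ (mem A)) // card_gt0. Qed.

Definition ns_sub (A0 : A != set0) : nsposet :=
  @NSPoset sp_sub (sub_nonempty A0).

End Sub.

Lemma ex_le2_max (P : nsposet) : exists g : P, [forall x : P, le2 x g].
Proof.
have [_ _ t] := le2_order P.
have /card_gt0P [x0 _] := ns_nonempty P.
have [g _ gmax] := arg_maxnP (P := predT)
  (fun x : P => #|[set y : P | le2 y x]|) (isT : predT x0).
exists g; apply/forallP => x; have /orP [//|gx] := le2_total x g.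
have := gmax x isT; rewrite /= leqNgt; apply: contraNT => nxg.
apply: proper_card; apply/properP; split.
  by apply/subsetP => y; rewrite !inE => yg; apply: t yg gx.
by exists x; rewrite inE //; case: (le2_order P).
Qed.

Definition gmax (P : nsposet) : P := xchoose (ex_le2_max P).

Lemma gmaxP (P : nsposet) (x : P) : le2 x (gmax P).
Proof. by have /forallP := xchooseP (ex_le2_max P). Qed.

Section Products.
Variables P Q : sposet.

Definition sum_rel (r : rel P) (s : rel Q) (b : P -> Q -> bool) : rel (P + Q) :=
  fun u v => match u, v with
  | inl x, inl y => r x y
  | inr x, inr y => s x y
  | inl x, inr y => b x y
  | inr _, inl _ => false
  end.

Lemma sum_rel_order (r : rel P) (s : rel Q) (b : P -> Q -> bool) :
    partial_order r -> partial_order s ->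
    (forall x x' y, r x x' -> b x' y -> b x y) ->
    (forall x y y', b x y -> s y y' -> b x y') ->
  partial_order (sum_rel r s b).
Proof.
case=> rr ra rt [sr sa st] bl br; split.
- by case=> x /=.
- by case=> x [] y //=; rewrite ?andbF //; [move/ra->|move/sa->].
- case=> y [] x [] z //=; [exact: rt|exact: bl| |exact: st].
  by move=> xy /(br _ _ _ xy).
Qed.

Lemma sum_rel_total (r : rel P) (s : rel Q) : total r -> total s ->
  total (sum_rel r s (fun _ _ => true)).
Proof. by move=> rt st [] x [] y /=. Qed.

Definition sp_prod : sposet :=
  @SPoset (P + Q)%type (Finite.class (P + Q)%type)
    (sum_rel le1 le1 (fun _ _ => false)) (sum_rel le2 le2 (fun _ _ => true))
    (sum_rel_order (b := fun _ _ => false) (le1_order P) (le1_order Q)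
       (fun _ _ _ _ h => h) (fun _ _ _ h _ => h))
    (sum_rel_order (b := fun _ _ => true) (le2_order P) (le2_order Q)
       (fun _ _ _ _ h => h) (fun _ _ _ h _ => h))
    (sum_rel_total (@le2_total P) (@le2_total Q)).

End Products.

Section NW.
Variables (P : nsposet) (Q : sposet).

Lemma nw_bl (x x' : P) (y : Q) :
  le1 x x' -> le1 x' (gmax P) -> le1 x (gmax P).
Proof. by case: (le1_order P) => _ _ t; apply: t. Qed.

Definition sp_nw : sposet :=
  @SPoset (P + Q)%type (Finite.class (P + Q)%type)
    (sum_rel le1 le1 (fun x _ => le1 x (gmax P)))
    (sum_rel le2 le2 (fun _ _ => true))
    (sum_rel_order (le1_order P) (le1_order Q) nw_bl (fun _ _ _ h _ => h))
    (sum_rel_order (b := fun _ _ => true) (le2_order P) (le2_order Q)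
       (fun _ _ _ _ h => h) (fun _ _ _ h _ => h))
    (sum_rel_total (@le2_total P) (@le2_total Q)).

End NW.

Lemma sum_nonempty (P : nsposet) (Q : sposet) : (0 < #|{: P + Q}|)%N.
Proof. by rewrite card_sum addn_gt0 ns_nonempty. Qed.

Definition ns_prod (P Q : nsposet) : nsposet :=
  @NSPoset (sp_prod P Q) (sum_nonempty P Q).

Definition ns_nw (P Q : nsposet) : nsposet :=
  @NSPoset (sp_nw P Q) (sum_nonempty P Q).

Definition is_ideal (P : sposet) (I : {set P}) : bool :=
  [forall x : P, forall y : P, (x \in I) && le1 x y ==> (y \in I)].

Definition nontrivial_ideal (P : sposet) (I : {set P}) : bool :=
  [&& is_ideal I, I != set0 & I != [set: P]].

Definition ntideal (P : sposet) := {I : {set P} | nontrivial_ideal I}.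

Lemma ntideal_neq0 P (I : ntideal P) : val I != set0.
Proof. by case: I => I /= /and3P []. Qed.

Lemma ntideal_setC_neq0 P (I : ntideal P) : ~: val I != set0.
Proof.
case: I => I /= /and3P [_ _]; apply: contraNneq => I0.
by rewrite -(setCK I) I0 setC0.
Qed.

Definition ideal_part (P : sposet) (I : ntideal P) : nsposet :=
  ns_sub (ntideal_neq0 I).

Definition coideal_part (P : sposet) (I : ntideal P) : nsposet :=
  ns_sub (ntideal_setC_neq0 I).

Lemma sum_map_bij (A A' B B' : Type) (f : A -> A') (g : B -> B') :
  bijective f -> bijective g ->
  bijective (fun u : A + B => match u with
    | inl x => inl (f x) | inr y => inr (g y) end).
Proof.
case=> f' fK f'K [g' gK g'K].
exists (fun u => match u with inl x => inl (f' x) | inr y => inr (g' y) end).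
- by case=> x; rewrite ?fK ?gK.
- by case=> x; rewrite ?f'K ?g'K.
Qed.

Lemma prod_iso (P P' Q Q' : nsposet) :
  sp_iso P P' -> sp_iso Q Q' -> sp_iso (ns_prod P Q) (ns_prod P' Q').
Proof.
case=> f [bf f1 f2] [g [bg g1 g2]].
exists (fun u : P + Q => match u with
  | inl x => inl (f x) | inr y => inr (g y) end).
by split; [exact: sum_map_bij|case=> x [] y /=..].
Qed.

Lemma iso_gmax (P P' : nsposet) (f : P -> P') : bijective f ->
  (forall x y, le2 (f x) (f y) = le2 x y) -> f (gmax P) = gmax P'.
Proof.
case=> g fK gK f2; case: (le2_order P') => _ anti _.
by apply: anti; rewrite gmaxP -[gmax P']gK f2 gmaxP.
Qed.

Lemma nw_iso (P P' Q Q' : nsposet) :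
  sp_iso P P' -> sp_iso Q Q' -> sp_iso (ns_nw P Q) (ns_nw P' Q').
Proof.
case=> f [bf f1 f2] [g [bg g1 g2]].
exists (fun u : P + Q => match u with
  | inl x => inl (f x) | inr y => inr (g y) end).
split; [exact: sum_map_bij|case=> x [] y //=..].
by rewrite -(iso_gmax bf f2) f1.
Qed.

Section IdealIso.
Variables (P P' : nsposet) (f : P -> P') (g : P' -> P).
Hypotheses (fK : cancel f g) (gK : cancel g f).
Hypothesis f1 : forall x y, le1 (f x) (f y) = le1 x y.
Hypothesis f2 : forall x y, le2 (f x) (f y) = le2 x y.

Lemma preim_ideal (I : ntideal P) : nontrivial_ideal (g @^-1: val I).
Proof.
case: I => I /= /and3P [/forallP iI I0 IT]; apply/and3P; split.
- apply/forallP => x; apply/forallP => y; rewrite !inE.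
  by have /forallP/(_ (g y)) := iI (g x); rewrite -f1 !gK.
- case/set0Pn: I0 => x xI; apply/set0Pn; exists (f x).
  by rewrite inE fK.
- apply: contraNneq IT => /setP E; apply/eqP/setP => x.
  by have := E (f x); rewrite !inE fK.
Qed.

Definition ntideal_map (I : ntideal P) : ntideal P' :=
  exist _ (g @^-1: val I) (preim_ideal I).

Lemma sub_iso (A : {set P}) (A' : {set P'}) :
  (forall x, (f x \in A') = (x \in A)) -> sp_iso (sp_sub A) (sp_sub A').
Proof.
move=> E.
have fA (u : {x : P | x \in A}) : f (val u) \in A' by rewrite E (valP u).
have gA (u : {x : P' | x \in A'}) : g (val u) \in A by rewrite -E gK (valP u).
exists (fun u : {x : P | x \in A} => exist _ (f (val u)) (fA u)); split.
- exists (fun u : {x : P' | x \in A'} => exist _ (g (val u)) (gA u)).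
  + by move=> u; apply: val_inj; rewrite /= fK.
  + by move=> u; apply: val_inj; rewrite /= gK.
- by move=> x y; apply: f1.
- by move=> x y; apply: f2.
Qed.

Lemma ideal_part_iso (I : ntideal P) :
  sp_iso (ideal_part I) (ideal_part (ntideal_map I)).
Proof. by apply: sub_iso => x; rewrite inE fK. Qed.

Lemma coideal_part_iso (I : ntideal P) :
  sp_iso (coideal_part I) (coideal_part (ntideal_map I)).
Proof. by apply: sub_iso => x; rewrite !inE fK. Qed.

Lemma gmax_ntideal_map (I : ntideal P) :
  (gmax P' \in val (ntideal_map I)) = (gmax P \in val I).
Proof.
by rewrite inE -(iso_gmax (f := f)) ?fK //; exists g.
Qed.

End IdealIso.

Lemma ntideal_mapK (P P' : nsposet) (f : P -> P') (g : P' -> P)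
    (fK : cancel f g) (gK : cancel g f)
    (f1 : forall x y, le1 (f x) (f y) = le1 x y)
    (g1 : forall x y, le1 (g x) (g y) = le1 x y) :
  cancel (ntideal_map fK gK f1) (ntideal_map gK fK g1).
Proof. by move=> I; apply/val_inj/setP => x; rewrite !inE /= fK. Qed.

Notation Hplus K := {freeg spclass / K}.

Section Hplus.
Variable K : fieldType.

Definition basis (P : nsposet) : Hplus K := << iso_class P >>.

(* The operations below are given on isomorphism classes through
   representatives, and extended (bi)linearly; the lemmas [Hmul_basis],
   [Hnw_basis], [Hleft_basis] and [Hright_basis] show that they do not depend
   on the representatives. *)

Definition bilin_ext (f : nsposet -> nsposet -> nsposet) (x y : Hplus K) :
    Hplus K :=
  fglift (fun c => fglift (fun c' =>
    basis (f (class_repr c) (class_repr c'))) y) x.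

Definition Hmul : Hplus K -> Hplus K -> Hplus K := bilin_ext ns_prod.

Definition Hnw : Hplus K -> Hplus K -> Hplus K := bilin_ext ns_nw.

Definition left_cut (P : nsposet) : (Hplus K ⊗ Hplus K)%type :=
  \sum_(I : ntideal P | gmax P \notin val I)
    (basis (coideal_part I) ⊗ basis (ideal_part I)).

Definition right_cut (P : nsposet) : (Hplus K ⊗ Hplus K)%type :=
  \sum_(I : ntideal P | gmax P \in val I)
    (basis (coideal_part I) ⊗ basis (ideal_part I)).

Definition Hleft : Hplus K -> (Hplus K ⊗ Hplus K)%type :=
  fglift (fun c => left_cut (class_repr c)).

Definition Hright : Hplus K -> (Hplus K ⊗ Hplus K)%type :=
  fglift (fun c => right_cut (class_repr c)).

Lemma basis_iso (P Q : nsposet) : sp_iso P Q -> basis P = basis Q.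
Proof. by move=> i; congr << _ >>; apply/iso_classP. Qed.

Lemma Hmul_basis P Q : Hmul (basis P) (basis Q) = basis (ns_prod P Q).
Proof.
rewrite /Hmul /bilin_ext !fglift_basis; apply: basis_iso.
by apply: prod_iso; apply: class_repr_iso.
Qed.

Lemma Hnw_basis P Q : Hnw (basis P) (basis Q) = basis (ns_nw P Q).
Proof.
rewrite /Hnw /bilin_ext !fglift_basis; apply: basis_iso.
by apply: nw_iso; apply: class_repr_iso.
Qed.

Lemma cut_iso (P P' : nsposet) : sp_iso P P' ->
  left_cut P = left_cut P' /\ right_cut P = right_cut P'.
Proof.
case=> f [[g fK gK] f1 f2].
have g1 x y : le1 (g x) (g y) = le1 x y by rewrite -f1 !gK.
have h_bij : bijective (ntideal_map fK gK f1).
  by exists (ntideal_map gK fK g1); apply: ntideal_mapK.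
rewrite /left_cut /right_cut.
split; rewrite [RHS](reindex (ntideal_map fK gK f1)) /=;
  try exact: onW_bij; apply: eq_big => I;
  rewrite ?(gmax_ntideal_map fK gK f1 f2) // => _;
  by rewrite (basis_iso (ideal_part_iso fK gK f1 f2 I))
             (basis_iso (coideal_part_iso fK gK f1 f2 I)).
Qed.

Lemma Hleft_basis P : Hleft (basis P) = left_cut P.
Proof. by rewrite /Hleft fglift_basis; case: (cut_iso (class_repr_iso P)). Qed.

Lemma Hright_basis P : Hright (basis P) = right_cut P.
Proof. by rewrite /Hright fglift_basis; case: (cut_iso (class_repr_iso P)). Qed.

End Hplus.

(* Main.v *)
Require Import Defs.
From mathcomp Require Import all_boot all_order all_algebra.
From mathcomp Require Import freeg.

Set Implicit Arguments.
Unset Strict Implicit.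
Unset Printing Implicit Defensive.

Import GRing.Theory.
Local Open Scope ring_scope.

(** Every identity is multilinear, so it suffices to prove it on special posets,
where all three kinds of axioms become bijections between index sets.

The sums become uniform once the basis is extended by 0 to the empty special
poset ([sbasis]): a coproduct of P is then the sum of (P \ I) ⊗ I over all the
ideals I of P satisfying the condition on the maximum, since the trivial ideals
contribute 0. Writing [sub_basis A] for the class of the restriction of P to a
subset A, all the terms that occur are indexed by subsets of one fixed poset.

Duplicial axioms: the associativity bijection of disjoint unions respects both
orders, because the maximum of P Q and of P ↖ Q is that of Q.

Dendriform axioms: an ideal I of P followed by an ideal J of P \ I is the same
as the ideal I ∪ J of P followed by its ideal I; both describe the filtration
of P into the blocks P \ (I ∪ J), J and I ([sum_ideal_chain]). The three axioms
say which block contains the maximum g of P: the first, the second or the third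
one respectively. The inner one-sided coproducts are only applied to
restrictions of P that contain g, and then g is also their maximum.

Compatibilities: a subset of P Q or of P ↖ Q is a pair (I, J) of subsets of P
and Q. It is an ideal of P Q when I and J are ideals; it is an ideal of P ↖ Q
when moreover J = Q as soon as I contains the maximum of P. Restricting P ↖ Q to
(I, J) gives I ↖ J if I contains the maximum of P, and the product I J if I is
an ideal that does not. Separating the cases where I or J is empty or full from
those where it is a nontrivial ideal produces the terms of the four formulas
([cut_left_mul], [cut_right_mul], [cut_left_nw], [cut_right_nw]). *)

(** * Linear and bilinear maps *)

Section Multilinear.
Variable K : fieldType.
Implicit Types U V W : lmodType K.

Lemma linear_map0 U V (f : U -> V) : linear f -> f 0 = 0.
Proof.
move=> fL; have := fL 1 0 0; rewrite !scale1r addr0 => /esym/eqP.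
by rewrite -subr_eq0 addrK => /eqP.
Qed.

Lemma linear_sum_morph U V (f : U -> V) (I : Type) (r : seq I) (P : pred I) F :
  linear f -> f (\sum_(i <- r | P i) F i) = \sum_(i <- r | P i) f (F i).
Proof.
move=> fL; apply: (big_morph f) => [x y|]; last exact: linear_map0.
by rewrite -[x in LHS]scale1r fL scale1r.
Qed.

Lemma linear_idfun U : linear (fun x : U => x).
Proof. by []. Qed.

Lemma linear_add U V (f g : U -> V) :
  linear f -> linear g -> linear (fun x => f x + g x).
Proof.
move=> fL gL k x y; rewrite fL gL scalerDr !addrA.
by congr (_ + _); exact: addrAC.
Qed.

Lemma linear_comp U V W (f : V -> W) (g : U -> V) :
  linear f -> linear g -> linear (fun x => f (g x)).
Proof. by move=> fL gL k x y; rewrite gL fL. Qed.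

Lemma linear_left U V W V' (f : V -> V' -> W) (g : U -> V) b :
  bilinear_map f -> linear g -> linear (fun x => f (g x) b).
Proof. by case=> fl _ gL; apply: (linear_comp (fl b) gL). Qed.

Lemma linear_right U V W V' (f : V' -> V -> W) (g : U -> V) b :
  bilinear_map f -> linear g -> linear (fun x => f b (g x)).
Proof. by case=> _ fr gL; apply: (linear_comp (fr b) gL). Qed.

Lemma linear_tlift U V W V' (f : V -> V' -> W) (d : U -> (V ⊗ V')%type) :
  bilinear_map f -> linear d -> linear (fun x => tlift f (d x)).
Proof. by move=> fB; apply: linear_comp; apply: tlift_linear. Qed.

(** Together with [linear_tlift], this makes nested Sweedler sums multilinear:
the variable may occur in the expanded tensor or in the summand. *)
Lemma linear_tlift_param U V W V' (f : U -> V -> V' -> W) t :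
    (forall x, bilinear_map (f x)) ->
    (forall a b, linear (fun x => f x a b)) ->
  linear (fun x => tlift (f x) t).
Proof.
move=> fB fL k x y; elim/tensor_ind: t => [|a b t IHt].
  by rewrite !(linear_map0 (tlift_linear (fB _))) scaler0 addr0.
have tD z u v : tlift (f z) (u + v) = tlift (f z) u + tlift (f z) v.
  by rewrite -[u in LHS]scale1r (tlift_linear (fB z)) scale1r.
rewrite !tD IHt !tlift_tens // fL scalerDr !addrA.
by congr (_ + _); exact: addrAC.
Qed.

Lemma tlift_sum U V W (f : U -> V -> W) (I : Type) (r : seq I) (P : pred I)
    (a : I -> U) (b : I -> V) :
  bilinear_map f ->
  tlift f (\sum_(i <- r | P i) (a i ⊗ b i)) = \sum_(i <- r | P i) f (a i) (b i).
Proof.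
move=> fB; rewrite (linear_sum_morph _ _ _ (tlift_linear fB)).
by apply: eq_bigr => i _; rewrite tlift_tens.
Qed.

Lemma tens_suml U V (I : Type) (r : seq I) (P : pred I) (a : I -> U) (b : V) :
  (\sum_(i <- r | P i) a i) ⊗ b = \sum_(i <- r | P i) (a i ⊗ b).
Proof.
by apply: (linear_sum_morph (f := fun x => x ⊗ b)); case: (tens_bilinear U V).
Qed.

Lemma tens_sumr U V (I : Type) (r : seq I) (P : pred I) (a : U) (b : I -> V) :
  a ⊗ (\sum_(i <- r | P i) b i) = \sum_(i <- r | P i) (a ⊗ b i).
Proof.
by apply: (linear_sum_morph (f := fun x => a ⊗ x)); case: (tens_bilinear U V).
Qed.

Lemma tens0l U V (b : V) : (0 : U) ⊗ b = 0.
Proof. exact: (linear_map0 (proj1 (tens_bilinear U V) b)). Qed.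

Lemma tens0r U V (a : U) : a ⊗ (0 : V) = 0.
Proof. exact: (linear_map0 (proj2 (tens_bilinear U V) a)). Qed.

End Multilinear.

(** Linearity is established by following the syntax of an expression built from
variables, sums, tensors, Sweedler sums and the (bi)linear maps whose
(bi)linearity is a hypothesis of the context. *)
Ltac multilinear :=
  repeat match goal with
  | |- forall _, _ => intro
  | |- bilinear_map _ => split
  | |- _ => progress cbv beta
  | |- _ => assumption
  | |- _ => solve [apply: linear_idfun]
  | |- _ => solve [apply: tens_bilinear | apply: (proj2 (tens_bilinear _ _))]
  | H : bilinear_map ?f |- _ => first
    [ solve [apply: (proj2 H)]
    | apply: (linear_left (f := f) _ H)
    | apply: (linear_right (f := f) _ H) ]
  | |- _ => first
    [ apply: linear_add | apply: linear_tlift_param | apply: linear_tlift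
    | apply: linear_left; first exact: tens_bilinear
    | apply: linear_right; first exact: tens_bilinear
    | apply: linear_comp; first eassumption ]
  end.

Section TensorMaps.
Variable K : fieldType.
Implicit Types A B C D : lmodType K.

Lemma tmap_bilinear A B C D (f : A -> C) (g : B -> D) : linear f -> linear g ->
  bilinear_map (fun a b => f a ⊗ g b).
Proof. by move=> fL gL; multilinear. Qed.

Lemma tmap_linear A B C D (f : A -> C) (g : B -> D) :
  linear f -> linear g -> linear (tmap f g).
Proof. by move=> fL gL; apply/tlift_linear/tmap_bilinear. Qed.

Lemma tassoc_bilinear A B C :
  bilinear_map (fun s (c : C) => \sw (a, b <- s) ((a : A) ⊗ ((b : B) ⊗ c))).
Proof. multilinear. Qed.

Lemma tassoc_linear A B C : linear (@tassoc K A B C).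
Proof. exact/tlift_linear/tassoc_bilinear. Qed.

Lemma tassoc_tens A B C (a : A) (b : B) (c : C) :
  tassoc (a ⊗ b ⊗ c) = a ⊗ (b ⊗ c).
Proof.
rewrite /tassoc (tlift_tens (tassoc_bilinear A B C)) tlift_tens //.
by multilinear.
Qed.

End TensorMaps.

Lemma coprod_linear (K : fieldType) (A : lmodType K)
    (dl dr : A -> (A ⊗ A)%type) :
  linear dl -> linear dr -> linear (coprod dl dr).
Proof. exact: linear_add. Qed.

Section BasisExt.
Variable K : fieldType.
Implicit Types V : lmodType K.

Lemma basis_linear_ext V (f g : Hplus K -> V) : linear f -> linear g ->
  (forall P, f (basis K P) = g (basis K P)) -> forall x, f x = g x.
Proof.
move=> fL gL fg; elim/freeg_lin_ind => [|k c x IHx].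
  by rewrite !linear_map0.
by rewrite fL gL IHx -[c]class_reprK fg.
Qed.

Lemma basis_bilinear_ext V (f g : Hplus K -> Hplus K -> V) :
    bilinear_map f -> bilinear_map g ->
    (forall P Q, f (basis K P) (basis K Q) = g (basis K P) (basis K Q)) ->
  forall x y, f x y = g x y.
Proof.
move=> [fl fr] [gl gr] fg x y.
apply: (basis_linear_ext (fl y) (gl y)) => P.
exact: (basis_linear_ext (fr _) (gr _)).
Qed.

Lemma bilin_ext_bilinear f : bilinear_map (@bilin_ext K f).
Proof.
split=> [v|u]; first exact: fglift_linear.
rewrite /bilin_ext => k x y.
elim/freeg_lin_ind: u => [|l c u IHu]; first by rewrite !fglift0 scaler0 addr0.
rewrite !fgliftD !fgliftZ !fglift_basis IHu fglift_linear.
rewrite !scalerDr !addrA !scalerA [l * k]mulrC.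
by congr (_ + _); exact: addrAC.
Qed.

Lemma Hmul_bilinear : bilinear_map (@Hmul K).
Proof. exact: bilin_ext_bilinear. Qed.

Lemma Hnw_bilinear : bilinear_map (@Hnw K).
Proof. exact: bilin_ext_bilinear. Qed.

Lemma Hleft_linear : linear (@Hleft K).
Proof. exact: fglift_linear. Qed.

Lemma Hright_linear : linear (@Hright K).
Proof. exact: fglift_linear. Qed.

End BasisExt.

(** * Isomorphisms of special posets *)

(** Injectivity comes for free: ≤₂ is antisymmetric, so a map that reflects it
is injective. *)
Lemma sp_iso_surj (P Q : sposet) (f : P -> Q) : (forall y, exists x, f x = y) ->
    (forall x y, le1 (f x) (f y) = le1 x y) ->
    (forall x y, le2 (f x) (f y) = le2 x y) ->
  sp_iso P Q.
Proof.
move=> f_surj f1 f2; exists f; split=> //.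
have f_ex y : exists x, f x == y by case: (f_surj y) => x <-; exists x.
have gK : cancel (fun y => xchoose (f_ex y)) f.
  by move=> y; apply/eqP/(xchooseP (f_ex y)).
exists (fun y => xchoose (f_ex y)) => // x.
case: (le2_order P) => r a _; apply: a.
by rewrite -f2 gK f2 r -f2 gK f2 r.
Qed.

Lemma le2_max_unique (P : nsposet) (g : P) : (forall x, le2 x g) -> gmax P = g.
Proof.
by move=> gM; case: (le2_order P) => _ anti _; apply: anti; rewrite gM gmaxP.
Qed.

Lemma gmax_prod (P Q : nsposet) : gmax (ns_prod P Q) = inr (gmax Q).
Proof. by apply: le2_max_unique; case=> x //=; apply: gmaxP. Qed.

Lemma gmax_nw (P Q : nsposet) : gmax (ns_nw P Q) = inr (gmax Q).
Proof. by apply: le2_max_unique; case=> x //=; apply: gmaxP. Qed.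

(** This is why the one-sided coproducts of a restriction can be computed with
the maximum of the ambient poset. *)
Lemma gmax_sub (P : nsposet) (A : {set P}) (A0 : A != set0) :
  gmax P \in A -> val (gmax (ns_sub A0)) = gmax P.
Proof.
move=> gA; rewrite (le2_max_unique (g := exist _ (gmax P) gA : ns_sub A0)) //=.
by move=> x; apply: gmaxP.
Qed.

Definition sum_assoc (A B C : Type) (u : (A + B) + C) : A + (B + C) :=
  match u with
  | inl (inl x) => inl x | inl (inr y) => inr (inl y) | inr z => inr (inr z)
  end.

Lemma sum_assoc_surj A B C (v : A + (B + C)) : exists u, sum_assoc u = v.
Proof.
case: v => [x|[y|z]]; [by exists (inl (inl x))|by exists (inl (inr y))|].
by exists (inr z).
Qed.

Lemma prodA_iso (P Q R : nsposet) :
  sp_iso (ns_prod (ns_prod P Q) R) (ns_prod P (ns_prod Q R)).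
Proof.
apply: (@sp_iso_surj (ns_prod (ns_prod P Q) R) (ns_prod P (ns_prod Q R))
  (@sum_assoc P Q R)); first exact: sum_assoc_surj.
  by case=> [[x|x]|x] [[y|y]|y].
by case=> [[x|x]|x] [[y|y]|y].
Qed.

(** In (P ↖ Q) ↖ R the elements below R are those below the maximum of P ↖ Q,
which lies in Q; for an element of P this again means to be below the maximum
of P. *)
Lemma nwA_iso (P Q R : nsposet) :
  sp_iso (ns_nw (ns_nw P Q) R) (ns_nw P (ns_nw Q R)).
Proof.
apply: (@sp_iso_surj (ns_nw (ns_nw P Q) R) (ns_nw P (ns_nw Q R))
  (@sum_assoc P Q R)); first exact: sum_assoc_surj.
  by case=> [[x|x]|x] [[y|y]|y]; rewrite //= gmax_nw.
by case=> [[x|x]|x] [[y|y]|y].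
Qed.

(** The maximum of P Q lies in Q, to which no element of P is comparable, so
that P stays incomparable to R. *)
Lemma prod_nw_iso (P Q R : nsposet) :
  sp_iso (ns_nw (ns_prod P Q) R) (ns_prod P (ns_nw Q R)).
Proof.
apply: (@sp_iso_surj (ns_nw (ns_prod P Q) R) (ns_prod P (ns_nw Q R))
  (@sum_assoc P Q R)); first exact: sum_assoc_surj.
  by case=> [[x|x]|x] [[y|y]|y]; rewrite //= gmax_prod.
by case=> [[x|x]|x] [[y|y]|y].
Qed.

Lemma H_duplicial (K : fieldType) : duplicial_algebra (@Hmul K) (@Hnw K).
Proof.
have mB := Hmul_bilinear K; have nB := Hnw_bilinear K.
split=> // x y z; move: x y.
- apply: (basis_bilinear_ext (f := fun x y => Hmul (Hmul x y) z)
    (g := fun x y => Hmul x (Hmul y z))); [multilinear..|] => P Q.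
  move: z; apply: basis_linear_ext; [multilinear..|] => R.
  by rewrite !Hmul_basis; apply/basis_iso/prodA_iso.
- apply: (basis_bilinear_ext (f := fun x y => Hnw (Hnw x y) z)
    (g := fun x y => Hnw x (Hnw y z))); [multilinear..|] => P Q.
  move: z; apply: basis_linear_ext; [multilinear..|] => R.
  by rewrite !Hnw_basis; apply/basis_iso/nwA_iso.
- apply: (basis_bilinear_ext (f := fun x y => Hnw (Hmul x y) z)
    (g := fun x y => Hmul x (Hnw y z))); [multilinear..|] => P Q.
  move: z; apply: basis_linear_ext; [multilinear..|] => R.
  by rewrite Hmul_basis !Hnw_basis Hmul_basis; apply/basis_iso/prod_nw_iso.
Qed.


(** * Restrictions *)

(** [sub_incl] and [sub_elt] fix the types of the projection and of the
constructor of a restriction, which otherwise get inferred as those of the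
underlying sigma type. *)
Definition sub_incl (P : sposet) (A : {set P}) (u : sp_sub A) : P := val u.

Lemma sub_incl_in (P : sposet) (A : {set P}) (u : sp_sub A) : sub_incl u \in A.
Proof. exact: (valP u). Qed.

Lemma sub_incl_inj (P : sposet) (A : {set P}) : injective (@sub_incl P A).
Proof. exact: val_inj. Qed.

Definition sub_elt (P : sposet) (A : {set P}) (x : P) (xA : x \in A) :
    sp_sub A := exist _ x xA.

Lemma sub_iso_surj (P Q : sposet) (A : {set Q}) (f : P -> Q) :
    (forall x, f x \in A) -> (forall y, y \in A -> exists x, f x = y) ->
    (forall x y, le1 (f x) (f y) = le1 x y) ->
    (forall x y, le2 (f x) (f y) = le2 x y) ->
  sp_iso P (sp_sub A).
Proof.
move=> fA f_surj f1 f2.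
apply: (@sp_iso_surj P (sp_sub A) (fun x => sub_elt (fA x))) => // y.
have [x fx] := f_surj _ (sub_incl_in y).
by exists x; apply: sub_incl_inj.
Qed.

(** It is used for restrictions of restrictions and for the two summands of a
disjoint union. *)
Lemma sub_imset_iso (P Q : sposet) (h : P -> Q) (A : {set P}) :
    (forall x y, le1 (h x) (h y) = le1 x y) ->
    (forall x y, le2 (h x) (h y) = le2 x y) ->
  sp_iso (sp_sub A) (sp_sub (h @: A)).
Proof.
move=> h1 h2; apply: (@sub_iso_surj (sp_sub A) Q _ (fun u => h (sub_incl u))).
- by move=> x; apply/imset_f/sub_incl_in.
- by move=> y /imsetP [x xA ->]; exists (sub_elt xA).
- by move=> x y; rewrite h1.
- by move=> x y; rewrite h2.
Qed.

Lemma sub_setT_iso (P : sposet) : sp_iso P (sp_sub [set: P]).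
Proof.
apply: (@sub_iso_surj P P _ id) => // y; first by rewrite inE.
by exists y.
Qed.

(** The subset I ⊔ J of a disjoint union; every subset has this form. *)
Definition sumset (S T : finType) (I : {set S}) (J : {set T}) : {set S + T} :=
  [set u | match u with inl x => x \in I | inr y => y \in J end].

Lemma sumset0r (S T : finType) (I : {set S}) :
  sumset I (set0 : {set T}) = inl @: I.
Proof.
apply/setP => -[x|y]; rewrite !inE; first by rewrite mem_imset // => u v [].
by apply/esym/imsetP => -[].
Qed.

Lemma sumset0l (S T : finType) (J : {set T}) :
  sumset (set0 : {set S}) J = inr @: J.
Proof.
apply/setP => -[x|y]; rewrite !inE; last by rewrite mem_imset // => u v [].
by apply/esym/imsetP => -[].
Qed.

Definition sum_incl (P Q : sposet) (I : {set P}) (J : {set Q})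
    (u : sp_sub I + sp_sub J) : P + Q :=
  match u with inl x => inl (sub_incl x) | inr y => inr (sub_incl y) end.

Lemma sum_incl_in (P Q : sposet) (I : {set P}) (J : {set Q})
    (u : sp_sub I + sp_sub J) : sum_incl u \in sumset I J.
Proof. by case: u => u; rewrite inE /= sub_incl_in. Qed.

Lemma sum_incl_surj (P Q : sposet) (I : {set P}) (J : {set Q})
    (v : P + Q) :
  v \in sumset I J -> exists u : sp_sub I + sp_sub J, sum_incl u = v.
Proof.
case: v => x; rewrite inE => xI.
  by exists (inl (sub_elt xI)).
by exists (inr (sub_elt xI)).
Qed.

Section SubSum.
Variables (P Q : sposet) (R : nsposet).
Variables (I : {set P}) (J : {set Q}) (A : {set R}).

Lemma sub_prod_iso :
  sp_iso (sp_prod (sp_sub I) (sp_sub J))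
         (sp_sub (sumset I J : {set sp_prod P Q})).
Proof.
apply: (@sub_iso_surj (sp_prod (sp_sub I) (sp_sub J)) (sp_prod P Q) _
  (@sum_incl P Q I J)).
- exact: sum_incl_in.
- exact: sum_incl_surj.
- by case=> x [] y.
- by case=> x [] y.
Qed.

(** The relations between the two sides of P ↖ Q go through the maximum of P,
which is still present in the restriction. *)
Lemma sub_nw_iso_nw (A0 : A != set0) : gmax R \in A ->
  sp_iso (sp_nw (ns_sub A0) (sp_sub J)) (sp_sub (sumset A J : {set sp_nw R Q})).
Proof.
move=> gA.
apply: (@sub_iso_surj (sp_nw (ns_sub A0) (sp_sub J)) (sp_nw R Q) _
  (@sum_incl R Q A J)).
- exact: sum_incl_in.
- exact: sum_incl_surj.
- by case=> x [] y //=; rewrite -(gmax_sub A0 gA).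
- by case=> x [] y.
Qed.

(** An element of an ideal that misses the maximum of P is not below it, hence
not below any element of Q: all relations between the two sides disappear. *)
Lemma sub_nw_iso_prod : is_ideal A -> gmax R \notin A ->
  sp_iso (sp_prod (sp_sub A) (sp_sub J))
         (sp_sub (sumset A J : {set sp_nw R Q})).
Proof.
move=> /forallP iA gA.
apply: (@sub_iso_surj (sp_prod (sp_sub A) (sp_sub J)) (sp_nw R Q) _
  (@sum_incl R Q A J)).
- exact: sum_incl_in.
- exact: sum_incl_surj.
- case=> x [] y //=; apply: contraNF gA => xg.
  have /forallP/(_ (gmax R)) := iA (sub_incl x).
  by rewrite sub_incl_in xg.
- by case=> x [] y.
Qed.

End SubSum.

(** * The basis, extended by zero to the empty special poset *)

Section Sbasis.
Variable K : fieldType.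

(** The value 0 on the empty poset makes the trivial ideals contribute nothing
to a coproduct, so that sums over nontrivial ideals may be replaced by sums over
all ideals. *)
Definition sbasis (P : sposet) : Hplus K :=
  (* [=P] rather than [idP], so that the case analysis does not abstract the
     boolean inside the proof of nonemptiness *)
  match (0 < #|{: P}|)%N =P true with
  | ReflectT h => basis K (NSPoset h)
  | ReflectF _ => 0
  end.

Definition sub_basis (P : sposet) (A : {set P}) : Hplus K := sbasis (sp_sub A).

Lemma sbasis_ns (P : nsposet) : sbasis P = basis K P.
Proof.
rewrite /sbasis; case: eqP => [h|]; last by rewrite ns_nonempty.
exact/basis_iso/sp_iso_refl.
Qed.

Lemma sbasis_empty (P : sposet) : #|{: P}| = 0%N -> sbasis P = 0.
Proof. by rewrite /sbasis; case: eqP => // h P0; have := h; rewrite P0. Qed.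

Lemma sp_iso_card (P Q : sposet) : sp_iso P Q -> #|{: P}| = #|{: Q}|.
Proof. by case=> f [/bij_eq_card]. Qed.

Lemma sbasis_iso (P Q : sposet) : sp_iso P Q -> sbasis P = sbasis Q.
Proof.
move=> i; have PQ := sp_iso_card i.
have [P0|P0] := posnP #|{: P}|; first by rewrite !sbasis_empty -?PQ.
have Q0 : (0 < #|{: Q}|)%N by rewrite -PQ.
rewrite -[P]/(NSPoset P0 : sposet) -[Q]/(NSPoset Q0 : sposet) !sbasis_ns.
exact: basis_iso.
Qed.

Lemma sp_sub0 (P : sposet) : #|{: sp_sub (set0 : {set P})}| = 0%N.
Proof. by apply: eq_card0 => u; have := sub_incl_in u; rewrite inE. Qed.

Lemma sub_basis_ns (P : sposet) (A : {set P}) (A0 : A != set0) :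
  sub_basis A = basis K (ns_sub A0).
Proof. exact: (sbasis_ns (ns_sub A0)). Qed.

Lemma sub_basis0 (P : sposet) : sub_basis (set0 : {set P}) = 0.
Proof. exact/sbasis_empty/sp_sub0. Qed.

Lemma sub_basisT (P : nsposet) : sub_basis [set: P] = basis K P.
Proof. by rewrite -sbasis_ns; apply/sbasis_iso/sp_iso_sym/sub_setT_iso. Qed.

Section SumBasis.
Variables (P : sposet) (Q : sposet) (I : {set P}) (J : {set Q}).
Let L : {set sp_prod P Q} := sumset I J.

Lemma sub_basis_prod : I != set0 -> J != set0 ->
  sub_basis L = Hmul (sub_basis I) (sub_basis J).
Proof.
move=> I0 J0; rewrite (sub_basis_ns I0) (sub_basis_ns J0) Hmul_basis -sbasis_ns.
exact/sbasis_iso/sp_iso_sym/sub_prod_iso.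
Qed.

End SumBasis.

Section NWBasis.
Variables (P : nsposet) (Q : sposet) (I : {set P}) (J : {set Q}).
Let L : {set sp_nw P Q} := sumset I J.

Lemma sub_basis_nw : gmax P \in I -> J != set0 ->
  sub_basis L = Hnw (sub_basis I) (sub_basis J).
Proof.
move=> gI J0; have I0 : I != set0 by apply/set0Pn; exists (gmax P).
rewrite (sub_basis_ns I0) (sub_basis_ns J0) Hnw_basis -sbasis_ns.
exact/sbasis_iso/sp_iso_sym/sub_nw_iso_nw.
Qed.

Lemma sub_basis_nw_ideal : is_ideal I -> gmax P \notin I ->
  sub_basis L = sub_basis (sumset I J : {set sp_prod P Q}).
Proof.
move=> iI gI.
apply: (etrans (sbasis_iso (sp_iso_sym (sub_nw_iso_prod _ iI gI)))).
exact/sbasis_iso/sub_prod_iso.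
Qed.

End NWBasis.

Section EmptySide.
Variables (P : nsposet) (Q : sposet) (I : {set P}) (J : {set Q}).

Lemma sub_basis_prod0r :
  sub_basis (sumset I set0 : {set sp_prod P Q}) = sub_basis I.
Proof.
rewrite sumset0r.
exact/sbasis_iso/sp_iso_sym/(@sub_imset_iso P (sp_prod P Q) inl).
Qed.

Lemma sub_basis_prod0l :
  sub_basis (sumset set0 J : {set sp_prod P Q}) = sub_basis J.
Proof.
rewrite sumset0l.
exact/sbasis_iso/sp_iso_sym/(@sub_imset_iso Q (sp_prod P Q) inr).
Qed.

Lemma sub_basis_nw0r :
  sub_basis (sumset I set0 : {set sp_nw P Q}) = sub_basis I.
Proof.
rewrite sumset0r.
exact/sbasis_iso/sp_iso_sym/(@sub_imset_iso P (sp_nw P Q) inl).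
Qed.

Lemma sub_basis_nw0l :
  sub_basis (sumset set0 J : {set sp_nw P Q}) = sub_basis J.
Proof.
rewrite sumset0l.
exact/sbasis_iso/sp_iso_sym/(@sub_imset_iso Q (sp_nw P Q) inr).
Qed.

End EmptySide.
End Sbasis.

(** * Cuts as sums over subsets *)

(** The ideals of the restriction to A, described inside the ambient poset. *)
Definition is_ideal_in (P : sposet) (A I : {set P}) : bool :=
  (I \subset A) &&
  [forall x : P, forall y : P, [&& x \in I, y \in A & le1 x y] ==> (y \in I)].

Lemma is_idealP (P : sposet) (I : {set P}) :
  reflect (forall x y, x \in I -> le1 x y -> y \in I) (is_ideal I).
Proof.
apply: (iffP idP) => [iI x y xI xy|iI].
  by have /forallP/(_ x)/forallP/(_ y) := iI; rewrite xI xy.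
apply/forallP => x; apply/forallP => y; apply/implyP => /andP [].
exact: iI.
Qed.

Lemma is_ideal_inP (P : sposet) (A I : {set P}) :
  reflect (I \subset A /\
      forall x y, x \in I -> y \in A -> le1 x y -> y \in I)
    (is_ideal_in A I).
Proof.
apply: (iffP andP) => -[IA iI]; split=> //.
  move=> x y xI yA xy.
  by have /forallP/(_ x)/forallP/(_ y) := iI; rewrite xI yA xy.
apply/forallP => x; apply/forallP => y; apply/implyP => /and3P [].
exact: iI.
Qed.

Section Cuts.
Variable K : fieldType.
Local Notation sb := (sub_basis K).

Lemma sum_ntideal (V : lmodType K) (P : nsposet) (p : pred {set P})
    (f : Hplus K -> Hplus K -> V) :
  \sum_(I : ntideal P | p (val I))
     f (basis K (coideal_part I)) (basis K (ideal_part I)) =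
  \sum_(I : {set P} | nontrivial_ideal I && p I) f (sb (~: I)) (sb I).
Proof.
rewrite [RHS](big_sub_cond (fun I : {set P} => nontrivial_ideal I) p).
by apply: eq_bigr => I _; rewrite -!sub_basis_ns.
Qed.

Lemma sum_ideal_nontrivial (P : nsposet) (p : pred {set P}) :
  \sum_(I : {set P} | is_ideal I && p I) (sb (~: I) ⊗ sb I) =
  \sum_(I : {set P} | nontrivial_ideal I && p I) (sb (~: I) ⊗ sb I).
Proof.
rewrite (bigID (fun I : {set P} => (I != set0) && (I != setT))) /=.
rewrite [X in _ + X]big1 ?addr0.
  by apply: eq_bigl => I; rewrite /nontrivial_ideal andbAC.
move=> I /andP [_]; rewrite negb_and !negbK => /orP [] /eqP ->.
  by rewrite sub_basis0 tens0r.
by rewrite setCT sub_basis0 tens0l.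
Qed.

Lemma left_cut_ideal (P : nsposet) : left_cut K P =
  \sum_(I : {set P} | is_ideal I && (gmax P \notin I)) (sb (~: I) ⊗ sb I).
Proof. by rewrite sum_ideal_nontrivial -(sum_ntideal _ (@tens K _ _)). Qed.

Lemma right_cut_ideal (P : nsposet) : right_cut K P =
  \sum_(I : {set P} | is_ideal I && (gmax P \in I)) (sb (~: I) ⊗ sb I).
Proof.
rewrite sum_ideal_nontrivial.
by rewrite -(sum_ntideal (fun I => gmax P \in I) (@tens K _ _)).
Qed.

Lemma tlift_Hleft (V : lmodType K) (f : Hplus K -> Hplus K -> V)
    (P : nsposet) :
  bilinear_map f -> tlift f (Hleft (basis K P)) =
  \sum_(I : {set P} | nontrivial_ideal I && (gmax P \notin I))
     f (sb (~: I)) (sb I).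
Proof.
move=> fB; rewrite Hleft_basis tlift_sum //.
exact: (sum_ntideal (fun I => gmax P \notin I)).
Qed.

Lemma tlift_Hright (V : lmodType K) (f : Hplus K -> Hplus K -> V)
    (P : nsposet) :
  bilinear_map f -> tlift f (Hright (basis K P)) =
  \sum_(I : {set P} | nontrivial_ideal I && (gmax P \in I))
     f (sb (~: I)) (sb I).
Proof.
move=> fB; rewrite Hright_basis tlift_sum //.
exact: (sum_ntideal (fun I => gmax P \in I)).
Qed.

Lemma tlift_coprod (V : lmodType K) (f : Hplus K -> Hplus K -> V)
    (P : nsposet) :
  bilinear_map f -> tlift f (coprod (@Hleft K) (@Hright K) (basis K P)) =
  \sum_(I : {set P} | nontrivial_ideal I) f (sb (~: I)) (sb I).
Proof.
move=> fB; rewrite /coprod.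
have -> t u : tlift f (t + u) = tlift f t + tlift f u.
  by rewrite -[t in LHS]scale1r (tlift_linear fB) scale1r.
rewrite tlift_Hleft // tlift_Hright //.
by rewrite [RHS](bigID (fun I : {set P} => gmax P \in I)) addrC.
Qed.

Section Relative.
Variables (P : nsposet) (A : {set P}).

(** The coproduct of a restriction, with all terms expressed in the ambient
poset. *)
Lemma sum_sub_ideal (p : pred {set sp_sub A}) (q : pred {set P}) :
    (forall B : {set sp_sub A}, q (@sub_incl P A @: B) = p B) ->
  \sum_(B : {set sp_sub A} | is_ideal B && p B) (sb (~: B) ⊗ sb B) =
  \sum_(J : {set P} | is_ideal_in A J && q J) (sb (A :\: J) ⊗ sb J).
Proof.
move=> qp.
have incl_in (B : {set sp_sub A}) u :
    (sub_incl u \in @sub_incl P A @: B) = (u \in B).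
  exact/mem_imset/sub_incl_inj.
have sb_incl (B : {set sp_sub A}) : sb B = sb (@sub_incl P A @: B).
  exact/sbasis_iso/(@sub_imset_iso (sp_sub A) P).
rewrite [RHS](reindex_onto (fun B : {set sp_sub A} => @sub_incl P A @: B)
  (fun J => @sub_incl P A @^-1: J)) /=; last first.
  move=> J /andP [/is_ideal_inP [JA _] _]; apply/setP => x.
  apply/imsetP/idP => [[u + ->]|xJ]; first by rewrite inE.
  by exists (sub_elt (subsetP JA x xJ)); rewrite ?inE.
apply: eq_big => [B|B _].
  rewrite qp; have -> : @sub_incl P A @^-1: (@sub_incl P A @: B) == B.
    by apply/eqP/setP => u; rewrite inE incl_in.
  rewrite andbT; congr (_ && _).
  apply/is_idealP/is_ideal_inP => [iB|[_ iB] u v uB uv].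
    split; first by apply/subsetP => x /imsetP [u _ ->]; apply: sub_incl_in.
    move=> x y /imsetP [u uB ->] yA uy.
    by rewrite -[y]/(sub_incl (sub_elt yA)) incl_in; apply: iB uB _.
  rewrite -incl_in; apply: (iB (sub_incl u)) => //.
    by rewrite incl_in.
  exact: sub_incl_in.
rewrite (sb_incl (~: B)) (sb_incl B); congr (sb _ ⊗ _).
apply/setP => x; rewrite inE; apply/imsetP/andP => [[u uB ->]|[xB xA]].
  by rewrite incl_in sub_incl_in -in_setC.
by exists (sub_elt xA) => //; rewrite inE -incl_in.
Qed.

Lemma Hleft_sub : gmax P \in A -> Hleft (sb A) =
  \sum_(J : {set P} | is_ideal_in A J && (gmax P \notin J))
     (sb (A :\: J) ⊗ sb J).
Proof.
move=> gA; have A0 : A != set0 by apply/set0Pn; exists (gmax P).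
rewrite (sub_basis_ns _ A0) Hleft_basis left_cut_ideal.
apply: (@sum_sub_ideal (fun B => gmax (ns_sub A0) \notin B)) => B.
by rewrite -(gmax_sub A0 gA) (mem_imset _ _ (@sub_incl_inj P A)).
Qed.

Lemma Hright_sub : gmax P \in A -> Hright (sb A) =
  \sum_(J : {set P} | is_ideal_in A J && (gmax P \in J)) (sb (A :\: J) ⊗ sb J).
Proof.
move=> gA; have A0 : A != set0 by apply/set0Pn; exists (gmax P).
rewrite (sub_basis_ns _ A0) Hright_basis right_cut_ideal.
apply: (@sum_sub_ideal (fun B => gmax (ns_sub A0) \in B)) => B.
by rewrite -(gmax_sub A0 gA) (mem_imset _ _ (@sub_incl_inj P A)).
Qed.

Lemma coprod_sub : coprod (@Hleft K) (@Hright K) (sb A) =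
  \sum_(J : {set P} | is_ideal_in A J && true) (sb (A :\: J) ⊗ sb J).
Proof.
have [->|A0] := eqVneq A set0.
  rewrite sub_basis0 big1 => [|J /andP [/andP [+ _] _]]; last first.
    by rewrite subset0 => /eqP ->; rewrite sub_basis0 tens0r.
  rewrite /coprod (linear_map0 (@Hleft_linear K)).
  by rewrite (linear_map0 (@Hright_linear K)) addr0.
rewrite (sub_basis_ns _ A0) /coprod Hleft_basis Hright_basis.
rewrite left_cut_ideal right_cut_ideal addrC.
rewrite -(@sum_sub_ideal xpredT) //.
rewrite [RHS](bigID (fun B : {set sp_sub A} => gmax (ns_sub A0) \in B)) /=.
by congr (_ + _); apply: eq_bigl => B; rewrite andbT.
Qed.

End Relative.

(** Both sides run over the same filtrations of P by two ideals: the pair (I, J)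
on the left corresponds to (I ∪ J, I) on the right. The predicates carry the
conditions on the position of the maximum. *)
Lemma sum_ideal_chain (V : nmodType) (P : sposet) (p q p' q' : pred {set P})
    (F : {set P} -> {set P} -> {set P} -> V) :
    (forall I J : {set P}, J \subset I -> p J && q (I :\: J) = p' I && q' J) ->
  \sum_(I : {set P} | is_ideal I && p I)
     \sum_(J : {set P} | is_ideal_in (~: I) J && q J) F (~: I :\: J) J I =
  \sum_(I : {set P} | is_ideal I && p' I)
     \sum_(J : {set P} | is_ideal_in I J && q' J) F (~: I) (I :\: J) J.
Proof.
move=> pq; rewrite !pair_big_dep /=.
rewrite (reindex_onto (fun u : {set P} * {set P} => (u.2, u.1 :\: u.2))
  (fun u => (u.1 :|: u.2, u.1))) /=; last first.
  move=> [I J] /= /andP [_ /andP [/is_ideal_inP [+ _] _]].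
  rewrite subsetC => IJ; congr pair; apply/setP => x; rewrite !inE.
  have := subsetP IJ x; rewrite inE.
  by case: (x \in I) => //= /(_ isT)/negbTE ->.
apply: eq_big => [[I J]|[I J] /andP [_ /eqP [IJ]]] /=; last first.
  congr F; apply/setP => x; move/setP/(_ x): IJ; rewrite !inE.
  by case: (x \in I); case: (x \in J).
have [JI|nJI] := boolP (J \subset I); last first.
  rewrite [X in _ && X](negbTE _) ?andbF /is_ideal_in ?(negbTE nJI) ?andbF //.
  by apply: contra nJI => /eqP [<-]; apply: subsetUl.
(* the round trip of the reindexing is the identity exactly when J ⊆ I *)
have -> : (J :|: (I :\: J), J) == (I, J).
  by rewrite setDE setUIr setUCr setIT (setUidPr JI).
have pqIJ := pq _ _ JI.
rewrite andbT [LHS]andbACA pqIJ [RHS]andbACA; congr (_ && _).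
apply/andP/andP => -[].
  move=> /is_idealP iJ /is_ideal_inP [_ iIJ]; split.
    apply/is_idealP => x y xI xy.
    have [xJ|xJ] := boolP (x \in J); first exact: (subsetP JI) (iJ _ _ xJ xy).
    have [yJ|yJ] := boolP (y \in J); first exact: (subsetP JI).
    by have := iIJ x y; rewrite !inE xI xJ yJ => /(_ isT isT xy).
  by apply/is_ideal_inP; split=> // x y xJ _; apply: iJ.
move=> /is_idealP iI /is_ideal_inP [_ iJ]; split.
  apply/is_idealP => x y xJ xy; apply: (iJ x) => //.
  exact: iI (subsetP JI _ xJ) xy.
apply/is_ideal_inP; split.
  by apply/subsetP => x; rewrite !inE => /andP [].
move=> x y; rewrite !inE => /andP [_ xI] -> xy /=; exact: iI xI xy.
Qed.

(** The common form of the three dendriform axioms: d1 and d2 are only evaluated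
on the restrictions selected by p and p', where they are sums of cuts. *)
Lemma tassoc_cut_chain (P : nsposet)
    (d1 d2 : Hplus K -> (Hplus K ⊗ Hplus K)%type) (p q p' q' : pred {set P}) :
    linear d1 -> linear d2 ->
    (forall I J : {set P}, J \subset I -> p J && q (I :\: J) = p' I && q' J) ->
    (forall I : {set P}, p I -> d1 (sb (~: I)) =
       \sum_(J : {set P} | is_ideal_in (~: I) J && q J)
          (sb (~: I :\: J) ⊗ sb J)) ->
    (forall I : {set P}, p' I -> d2 (sb I) =
       \sum_(J : {set P} | is_ideal_in I J && q' J) (sb (I :\: J) ⊗ sb J)) ->
  tassoc (tmap d1 id
    (\sum_(I : {set P} | is_ideal I && p I) (sb (~: I) ⊗ sb I))) =
  tmap id d2 (\sum_(I : {set P} | is_ideal I && p' I) (sb (~: I) ⊗ sb I)).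
Proof.
move=> d1L d2L pq E1 E2; rewrite /tmap.
rewrite !tlift_sum; [|exact: tmap_bilinear..].
rewrite (linear_sum_morph _ _ _ (@tassoc_linear _ _ _ _)).
transitivity (\sum_(I : {set P} | is_ideal I && p I)
   \sum_(J : {set P} | is_ideal_in (~: I) J && q J)
      sb (~: I :\: J) ⊗ (sb J ⊗ sb I)).
  apply: eq_bigr => I /andP [_ pI].
  rewrite E1 // tens_suml (linear_sum_morph _ _ _ (@tassoc_linear _ _ _ _)).
  by apply: eq_bigr => J _; rewrite tassoc_tens.
rewrite (sum_ideal_chain (fun X Y Z => sb X ⊗ (sb Y ⊗ sb Z)) pq).
by apply: eq_bigr => I /andP [_ pI]; rewrite E2 // tens_sumr.
Qed.

Lemma coassoc_basis_ext (d d' d1 d2 : Hplus K -> (Hplus K ⊗ Hplus K)%type) :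
    linear d -> linear d' -> linear d1 -> linear d2 ->
    (forall P, tassoc (tmap d1 id (d (basis K P))) =
               tmap id d2 (d' (basis K P))) ->
  forall x, tassoc (tmap d1 id (d x)) = tmap id d2 (d' x).
Proof.
move=> dL d'L d1L d2L; apply: basis_linear_ext.
  exact: (linear_comp (@tassoc_linear _ _ _ _)
    (linear_comp (tmap_linear d1L (@linear_idfun _ _)) dL)).
exact: (linear_comp (tmap_linear (@linear_idfun _ _) d2L) d'L).
Qed.

Lemma H_dendriform : dendriform_coalgebra (@Hleft K) (@Hright K).
Proof.
have lL := @Hleft_linear K; have rL := @Hright_linear K.
have cL := coprod_linear lL rL.
split=> //; apply: coassoc_basis_ext => // P;
  rewrite ?Hleft_basis ?left_cut_ideal ?Hright_basis ?right_cut_ideal.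
- apply: (@tassoc_cut_chain P _ _ (fun I => gmax P \notin I)
    (fun J => gmax P \notin J) (fun I => gmax P \notin I) xpredT) => //.
  + move=> I J JI; rewrite in_setD; have := subsetP JI (gmax P).
    by case: (gmax P \in J); case: (gmax P \in I) => //= /(_ isT).
  + by move=> I gI; apply: Hleft_sub; rewrite inE.
  + by move=> I _; apply: coprod_sub.
- apply: (@tassoc_cut_chain P _ _ (fun I => gmax P \notin I)
    (fun J => gmax P \in J) (fun I => gmax P \in I)
    (fun J => gmax P \notin J)) => //.
  + by move=> I J JI; rewrite in_setD andbA andbb andbC.
  + by move=> I gI; apply: Hright_sub; rewrite inE.
  + exact: Hleft_sub.
- apply: (@tassoc_cut_chain P _ _ (fun I => gmax P \in I) xpredT
    (fun I => gmax P \in I) (fun J => gmax P \in J)) => //.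
  + move=> I J JI; rewrite andbT; have := subsetP JI (gmax P).
    by case: (gmax P \in J); case: (gmax P \in I) => //= /(_ isT).
  + by move=> I _; apply: coprod_sub.
  + exact: Hright_sub.
Qed.

End Cuts.

(** * Cuts of products *)

Lemma sumsetC (S T : finType) (I : {set S}) (J : {set T}) :
  ~: sumset I J = sumset (~: I) (~: J).
Proof. by apply/setP => -[x|x]; rewrite !inE. Qed.

Lemma sum_sumset (V : nmodType) (S T : finType) (p : pred {set S + T})
    (q : pred {set S}) (r : {set S} -> pred {set T}) (F : {set S + T} -> V) :
    (forall I J, p (sumset I J) = q I && r I J) ->
  \sum_(L | p L) F L = \sum_(I | q I) \sum_(J | r I J) F (sumset I J).
Proof.
move=> pqr; rewrite pair_big_dep /=.
rewrite (reindex (fun u : {set S} * {set T} => sumset u.1 u.2)) /=.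
  by apply: eq_bigl => -[I J]; rewrite pqr.
exists (fun L : {set S + T} => (inl @^-1: L, inr @^-1: L)).
  by case=> I J _ /=; congr pair; apply/setP => x; rewrite !inE.
by move=> L _; apply/setP => -[x|x]; rewrite !inE.
Qed.

Lemma is_ideal_prod (P Q : nsposet) (I : {set P}) (J : {set Q}) :
  is_ideal (sumset I J : {set ns_prod P Q}) = is_ideal I && is_ideal J.
Proof.
apply/is_idealP/andP => [iL|[/is_idealP iI /is_idealP iJ]].
  split; apply/is_idealP => x y.
    by have := iL (inl x) (inl y); rewrite !inE.
  by have := iL (inr x) (inr y); rewrite !inE.
by case=> x [] y //; rewrite !inE //=; [apply: iI|apply: iJ].
Qed.

(** The only relations from P to Q start below the maximum of P. So an ideal
that contains some element below this maximum contains the maximum, and hence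
all of Q. *)
Lemma is_ideal_nw (P Q : nsposet) (I : {set P}) (J : {set Q}) :
  is_ideal (sumset I J : {set ns_nw P Q}) =
  [&& is_ideal I, is_ideal J & (gmax P \in I) ==> (J == setT)].
Proof.
have [r _ _] := le1_order P.
apply/is_idealP/and3P => [iL|[/is_idealP iI /is_idealP iJ gIJ]].
  split; first 1 last.
  - apply/is_idealP => x y.
    by have := iL (inr x) (inr y); rewrite !inE.
  - apply/implyP => gI; rewrite -subTset; apply/subsetP => y _.
    by have := iL (inl (gmax P)) (inr y); rewrite !inE; apply=> //=.
  - apply/is_idealP => x y.
    by have := iL (inl x) (inl y); rewrite !inE.
case=> x [] y //; rewrite !inE //=; [exact: iI| |exact: iJ].
by move=> xI /(iI _ _ xI) gI; move: gIJ; rewrite gI => /eqP ->; rewrite inE.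
Qed.

Section Split.
Variables (P : nsposet) (V : nmodType) (G : {set P} -> V).

Lemma setT_neq0 : [set: P] != set0.
Proof. by apply/set0Pn; exists (gmax P). Qed.

Lemma is_ideal0 : is_ideal (set0 : {set P}).
Proof. by apply/is_idealP => x y; rewrite inE. Qed.

Lemma is_idealT : is_ideal [set: P].
Proof. by apply/is_idealP => x y; rewrite !inE. Qed.

Lemma sum_ideal_nogmax :
  \sum_(I : {set P} | is_ideal I && (gmax P \notin I)) G I =
  G set0 + \sum_(I : {set P} | nontrivial_ideal I && (gmax P \notin I)) G I.
Proof.
rewrite (bigD1 set0) /= ?is_ideal0 ?inE //; congr (_ + _).
apply: eq_bigl => I; rewrite /nontrivial_ideal.
have [->|IT] := eqVneq I setT; first by rewrite inE !andbF.
by rewrite andbT andbAC.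
Qed.

Lemma sum_ideal_gmax :
  \sum_(I : {set P} | is_ideal I && (gmax P \in I)) G I =
  G setT + \sum_(I : {set P} | nontrivial_ideal I && (gmax P \in I)) G I.
Proof.
rewrite (bigD1 setT) /= ?is_idealT ?inE //; congr (_ + _).
apply: eq_bigl => I; rewrite /nontrivial_ideal.
have [->|I0] := eqVneq I set0; first by rewrite inE !andbF.
by rewrite andbAC.
Qed.

Lemma sum_ideal_all :
  \sum_(I : {set P} | is_ideal I) G I =
  G set0 + (G setT + \sum_(I : {set P} | nontrivial_ideal I) G I).
Proof.
rewrite (bigID (fun I : {set P} => gmax P \notin I)) /= sum_ideal_nogmax.
under [X in _ + X]eq_bigl => I do rewrite negbK.
rewrite sum_ideal_gmax -!addrA; congr (_ + _).
rewrite addrCA; congr (_ + _).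
rewrite [RHS](bigID (fun I : {set P} => gmax P \notin I)) /=.
by congr (_ + _); apply: eq_bigl => I; rewrite negbK.
Qed.

End Split.

Lemma nontrivial_neq0 (P : sposet) (I : {set P}) :
  nontrivial_ideal I -> I != set0.
Proof. by case/and3P. Qed.

Lemma nontrivial_is_ideal (P : sposet) (I : {set P}) :
  nontrivial_ideal I -> is_ideal I.
Proof. by case/and3P. Qed.

Lemma nontrivialC_neq0 (P : sposet) (I : {set P}) :
  nontrivial_ideal I -> ~: I != set0.
Proof. by move=> nI; apply: (@ntideal_setC_neq0 P (exist _ I nI)). Qed.

Section CompatH.
Variable K : fieldType.
Local Notation sb := (sub_basis K).
Let mB := Hmul_bilinear K.
Let nB := Hnw_bilinear K.
Let lL := @Hleft_linear K.
Let rL := @Hright_linear K.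
Let cL : linear (coprod (@Hleft K) (@Hright K)).
Proof. exact: coprod_linear. Qed.

Section CutValues.
Variables (P Q : nsposet).
Implicit Types (I : {set P}) (J : {set Q}).
Local Notation sump I J := (sumset I J : {set sp_prod P Q}).
Local Notation sumn I J := (sumset I J : {set sp_nw P Q}).

Let sb0l J : sb (sump set0 J) = sb J.
Proof. exact: sub_basis_prod0l. Qed.

Let sb0r I : sb (sump I set0) = sb I.
Proof. exact: sub_basis_prod0r. Qed.

Let sbTl J : J != set0 -> sb (sump setT J) = Hmul (basis K P) (sb J).
Proof. by move=> J0; rewrite sub_basis_prod ?setT_neq0 ?sub_basisT. Qed.

Let sbTr I : I != set0 -> sb (sump I setT) = Hmul (sb I) (basis K Q).
Proof. by move=> I0; rewrite sub_basis_prod ?setT_neq0 ?sub_basisT. Qed.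

Let nwTl J : J != set0 -> sb (sumn setT J) = Hnw (basis K P) (sb J).
Proof. by move=> J0; rewrite sub_basis_nw ?inE ?sub_basisT. Qed.

Let nwTr I : gmax P \in I -> sb (sumn I setT) = Hnw (sb I) (basis K Q).
Proof. by move=> gI; rewrite sub_basis_nw ?setT_neq0 ?sub_basisT. Qed.

Let nw0r I : sb (sumn I set0) = sb I.
Proof. exact: sub_basis_nw0r. Qed.

Let nw0l J : sb (sumn set0 J) = sb J.
Proof. exact: sub_basis_nw0l. Qed.

Let sbCT : sb (~: sump setT setT) = 0.
Proof. by rewrite sumsetC !setCT sb0l sub_basis0. Qed.

Let nwCT : sb (~: sumn setT setT) = 0.
Proof. by rewrite sumsetC !setCT nw0l sub_basis0. Qed.

(** The terms correspond in this order to the pairs (P, ∅), (P, J), (∅, J),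
(I, ∅) and (I, J) with I and J nontrivial ideals; (∅, ∅) contributes 0. *)
Lemma cut_left_mul : left_cut K (ns_prod P Q) =
  basis K Q ⊗ basis K P
  + \sum_(J : {set Q} | nontrivial_ideal J && (gmax Q \notin J))
      (sb (~: J) ⊗ Hmul (basis K P) (sb J))
  + \sum_(J : {set Q} | nontrivial_ideal J && (gmax Q \notin J))
      (Hmul (basis K P) (sb (~: J)) ⊗ sb J)
  + \sum_(I : {set P} | nontrivial_ideal I)
      (Hmul (sb (~: I)) (basis K Q) ⊗ sb I)
  + \sum_(I : {set P} | nontrivial_ideal I)
      \sum_(J : {set Q} | nontrivial_ideal J && (gmax Q \notin J))
        (Hmul (sb (~: I)) (sb (~: J)) ⊗ Hmul (sb I) (sb J)).
Proof.
rewrite left_cut_ideal.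
rewrite (sum_sumset _ (q := fun I : {set P} => is_ideal I)
    (r := fun _ (J : {set Q}) => is_ideal J && (gmax Q \notin J))); last first.
  by move=> I J; rewrite is_ideal_prod gmax_prod inE andbA.
rewrite sum_ideal_all !sum_ideal_nogmax.
under [X in _ + (_ + X)]eq_bigr => I _ do rewrite sum_ideal_nogmax.
rewrite big_split /= [X in _ ⊗ X]sb0l sub_basis0 tens0r add0r.
rewrite !addrA [LHS](ACl (2*3*1*4*5)).
congr (_ + _ + _ + _ + _).
- by rewrite sumsetC setCT setC0 [X in X ⊗ _]sb0l [X in _ ⊗ X]sb0r !sub_basisT.
- apply: eq_bigr => J /andP [nJ _].
  by rewrite sumsetC setCT [X in X ⊗ _]sb0l [X in _ ⊗ X]sbTl ?nontrivial_neq0.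
- apply: eq_bigr => J /andP [nJ _].
  rewrite sumsetC setC0 [X in X ⊗ _]sbTl ?nontrivialC_neq0 //.
  by rewrite [X in _ ⊗ X]sb0l.
- apply: eq_bigr => I nI.
  rewrite sumsetC setC0 [X in X ⊗ _]sbTr ?nontrivialC_neq0 //.
  by rewrite [X in _ ⊗ X]sb0r.
- apply: eq_bigr => I nI; apply: eq_bigr => J /andP [nJ _].
  rewrite sumsetC [X in X ⊗ _]sub_basis_prod ?nontrivialC_neq0 //.
  by rewrite [X in _ ⊗ X]sub_basis_prod ?nontrivial_neq0.
Qed.

(** Now J is nonempty: the terms correspond in this order to the pairs (∅, Q),
(∅, J), (P, J), (I, Q) and (I, J); (P, Q) contributes 0. *)
Lemma cut_right_mul : right_cut K (ns_prod P Q) =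
  basis K P ⊗ basis K Q
  + \sum_(J : {set Q} | nontrivial_ideal J && (gmax Q \in J))
      (Hmul (basis K P) (sb (~: J)) ⊗ sb J)
  + \sum_(J : {set Q} | nontrivial_ideal J && (gmax Q \in J))
      (sb (~: J) ⊗ Hmul (basis K P) (sb J))
  + \sum_(I : {set P} | nontrivial_ideal I)
      (sb (~: I) ⊗ Hmul (sb I) (basis K Q))
  + \sum_(I : {set P} | nontrivial_ideal I)
      \sum_(J : {set Q} | nontrivial_ideal J && (gmax Q \in J))
        (Hmul (sb (~: I)) (sb (~: J)) ⊗ Hmul (sb I) (sb J)).
Proof.
rewrite right_cut_ideal.
rewrite (sum_sumset _ (q := fun I : {set P} => is_ideal I)
    (r := fun _ (J : {set Q}) => is_ideal J && (gmax Q \in J))); last first.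
  by move=> I J; rewrite is_ideal_prod gmax_prod inE andbA.
rewrite sum_ideal_all !sum_ideal_gmax.
under [X in _ + (_ + X)]eq_bigr => I _ do rewrite sum_ideal_gmax.
rewrite big_split /= sbCT tens0l add0r.
rewrite !addrA.
congr (_ + _ + _ + _ + _).
- by rewrite sumsetC setCT setC0 [X in X ⊗ _]sb0r [X in _ ⊗ X]sb0l !sub_basisT.
- apply: eq_bigr => J /andP [nJ _].
  rewrite sumsetC setC0 [X in X ⊗ _]sbTl ?nontrivialC_neq0 //.
  by rewrite [X in _ ⊗ X]sb0l.
- apply: eq_bigr => J /andP [nJ _].
  by rewrite sumsetC setCT [X in X ⊗ _]sb0l [X in _ ⊗ X]sbTl ?nontrivial_neq0.
- apply: eq_bigr => I nI.
  by rewrite sumsetC setCT [X in X ⊗ _]sb0r [X in _ ⊗ X]sbTr ?nontrivial_neq0.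
- apply: eq_bigr => I nI; apply: eq_bigr => J /andP [nJ _].
  rewrite sumsetC [X in X ⊗ _]sub_basis_prod ?nontrivialC_neq0 //.
  by rewrite [X in _ ⊗ X]sub_basis_prod ?nontrivial_neq0.
Qed.

(** Here J ≠ Q, which forces I to miss the maximum of P: the terms correspond to
the pairs (∅, J), (I, ∅) and (I, J). *)
Lemma cut_left_nw : left_cut K (ns_nw P Q) =
  \sum_(J : {set Q} | nontrivial_ideal J && (gmax Q \notin J))
    (Hnw (basis K P) (sb (~: J)) ⊗ sb J)
  + \sum_(I : {set P} | nontrivial_ideal I && (gmax P \notin I))
      (Hnw (sb (~: I)) (basis K Q) ⊗ sb I)
  + \sum_(I : {set P} | nontrivial_ideal I && (gmax P \notin I))
      \sum_(J : {set Q} | nontrivial_ideal J && (gmax Q \notin J))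
        (Hnw (sb (~: I)) (sb (~: J)) ⊗ Hmul (sb I) (sb J)).
Proof.
rewrite left_cut_ideal.
rewrite (sum_sumset _ (q := fun I : {set P} => is_ideal I && (gmax P \notin I))
    (r := fun _ (J : {set Q}) => is_ideal J && (gmax Q \notin J))); last first.
  move=> I J; rewrite is_ideal_nw gmax_nw inE.
  have [-> | _] := eqVneq J setT; first by rewrite inE !andbF.
  rewrite implybF.
  by case: (is_ideal I); case: (is_ideal J); case: (gmax P \in I).
rewrite sum_ideal_nogmax !sum_ideal_nogmax.
under [X in _ + X]eq_bigr => I _ do rewrite sum_ideal_nogmax.
rewrite big_split /= [X in _ ⊗ X]nw0l sub_basis0 tens0r add0r !addrA.
congr (_ + _ + _).
- apply: eq_bigr => J /andP [nJ _].
  rewrite sumsetC setC0 [X in X ⊗ _]nwTl ?nontrivialC_neq0 //.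
  by rewrite [X in _ ⊗ X]nw0l.
- apply: eq_bigr => I /andP [nI gI]; have iI := nontrivial_is_ideal nI.
  rewrite sumsetC setC0 [X in X ⊗ _]nwTr ?in_setC //.
  by rewrite [X in _ ⊗ X]sub_basis_nw_ideal // sb0r.
- apply: eq_bigr => I /andP [nI gI]; apply: eq_bigr => J /andP [nJ _].
  have iI := nontrivial_is_ideal nI.
  rewrite sumsetC [X in X ⊗ _]sub_basis_nw ?in_setC ?nontrivialC_neq0 //.
  by rewrite [X in _ ⊗ X]sub_basis_nw_ideal // sub_basis_prod ?nontrivial_neq0.
Qed.

(** Unlike in the other three cases, the pairs (I, J) do not form a product:
J is forced to be Q when I contains the maximum of P. These I yield the second
sum and the vanishing term I = P, the others yield the remaining terms. *)
Lemma cut_right_nw : right_cut K (ns_nw P Q) =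
  basis K P ⊗ basis K Q
  + \sum_(J : {set Q} | nontrivial_ideal J && (gmax Q \in J))
      (Hnw (basis K P) (sb (~: J)) ⊗ sb J)
  + \sum_(I : {set P} | nontrivial_ideal I && (gmax P \in I))
      (sb (~: I) ⊗ Hnw (sb I) (basis K Q))
  + \sum_(I : {set P} | nontrivial_ideal I && (gmax P \notin I))
      (sb (~: I) ⊗ Hmul (sb I) (basis K Q))
  + \sum_(I : {set P} | nontrivial_ideal I && (gmax P \notin I))
      \sum_(J : {set Q} | nontrivial_ideal J && (gmax Q \in J))
        (Hnw (sb (~: I)) (sb (~: J)) ⊗ Hmul (sb I) (sb J)).
Proof.
rewrite right_cut_ideal.
rewrite (sum_sumset _ (q := fun I : {set P} => is_ideal I)
    (r := fun I (J : {set Q}) =>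
      (is_ideal J && (gmax Q \in J)) &&
      ((gmax P \in I) ==> (J == setT)))); last first.
  move=> I J; rewrite is_ideal_nw gmax_nw inE.
  by case: (is_ideal I); case: (is_ideal J) => //=; rewrite andbC.
rewrite (bigID (fun I : {set P} => gmax P \in I)) /= [X in X + _](eq_bigr
    (fun I : {set P} => sb (~: (sumn I setT)) ⊗ sb (sumn I setT))); last first.
  move=> I /andP [_ gI]; rewrite (big_pred1 setT) // => J.
  rewrite gI /=; have [->|] := eqVneq J setT; last by rewrite andbF.
  by rewrite is_idealT inE.
rewrite [X in _ + X](eq_bigr (fun I : {set P} =>
    \sum_(J : {set Q} | is_ideal J && (gmax Q \in J))
       (sb (~: (sumn I J)) ⊗ sb (sumn I J)))); last first.
  by move=> I /andP [_ /negbTE gI]; apply: eq_bigl => J; rewrite gI andbT.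
rewrite sum_ideal_gmax sum_ideal_nogmax sum_ideal_gmax.
under [X in _ + (_ + X)]eq_bigr => I _ do rewrite sum_ideal_gmax.
rewrite big_split /= nwCT tens0l add0r !addrA [LHS](ACl (2*3*1*4*5)).
congr (_ + _ + _ + _ + _).
- by rewrite sumsetC setCT setC0 [X in X ⊗ _]nw0r [X in _ ⊗ X]nw0l !sub_basisT.
- apply: eq_bigr => J /andP [nJ _].
  rewrite sumsetC setC0 [X in X ⊗ _]nwTl ?nontrivialC_neq0 //.
  by rewrite [X in _ ⊗ X]nw0l.
- apply: eq_bigr => I /andP [nI gI].
  by rewrite sumsetC setCT [X in X ⊗ _]nw0r [X in _ ⊗ X]nwTr.
- apply: eq_bigr => I /andP [nI gI]; have iI := nontrivial_is_ideal nI.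
  rewrite sumsetC setCT [X in X ⊗ _]nw0r [X in _ ⊗ X]sub_basis_nw_ideal //.
  by rewrite sbTr ?nontrivial_neq0.
- apply: eq_bigr => I /andP [nI gI]; apply: eq_bigr => J /andP [nJ _].
  have iI := nontrivial_is_ideal nI.
  rewrite sumsetC [X in X ⊗ _]sub_basis_nw ?in_setC ?nontrivialC_neq0 //.
  by rewrite [X in _ ⊗ X]sub_basis_nw_ideal // sub_basis_prod ?nontrivial_neq0.
Qed.

End CutValues.

Lemma H_left_mul : compat_left_mul (@Hmul K) (@Hleft K) (@Hright K).
Proof.
apply: basis_bilinear_ext; [by multilinear..|] => P Q.
rewrite (Hmul_basis K P Q) Hleft_basis cut_left_mul.
rewrite !tlift_Hleft; [|by multilinear..].
rewrite !tlift_coprod; [|by multilinear..].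
do ?congr (_ + _); apply: eq_bigr => I _.
by rewrite tlift_Hleft; [|by multilinear].
Qed.
Lemma H_right_mul : compat_right_mul (@Hmul K) (@Hleft K) (@Hright K).
Proof.
apply: basis_bilinear_ext; [by multilinear..|] => P Q.
rewrite (Hmul_basis K P Q) Hright_basis cut_right_mul.
rewrite !tlift_Hright; [|by multilinear..].
rewrite !tlift_coprod; [|by multilinear..].
do ?congr (_ + _); apply: eq_bigr => I _.
by rewrite tlift_Hright; [|by multilinear].
Qed.

Lemma H_left_nw : compat_left_nw (@Hmul K) (@Hnw K) (@Hleft K).
Proof.
apply: basis_bilinear_ext; [by multilinear..|] => P Q.
rewrite (Hnw_basis K P Q) Hleft_basis cut_left_nw.
rewrite !tlift_Hleft; [|by multilinear..].
do ?congr (_ + _); apply: eq_bigr => I _.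
by rewrite tlift_Hleft; [|by multilinear].
Qed.

Lemma H_right_nw : compat_right_nw (@Hmul K) (@Hnw K) (@Hleft K) (@Hright K).
Proof.
apply: basis_bilinear_ext; [by multilinear..|] => P Q.
rewrite (Hnw_basis K P Q) Hright_basis cut_right_nw.
rewrite !tlift_Hleft; [|by multilinear..].
rewrite !tlift_Hright; [|by multilinear..].
do ?congr (_ + _); apply: eq_bigr => I _.
by rewrite tlift_Hright; [|by multilinear].
Qed.

End CompatH.

(** * The bialgebra *)

Theorem proposition5p4 (K : fieldType) :
  @dup_dend_bialgebra K (Hplus K) (@Hmul K) (@Hnw K) (@Hleft K) (@Hright K).
Proof.
split.
- exact: H_duplicial.
- exact: H_dendriform.
- exact: H_left_mul.
- exact: H_right_mul.
- exact: H_left_nw.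
- exact: H_right_nw.
Qed.
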